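(* Let $F$ be a free group of finite rank $k\ge 2$. There does not exist a symmetric $Out(F)$-equivariant map $\hat I: Curr(F)\times Curr(F)\to\mathbb R$ (that is, a map with $\hat I(\mu,\nu)=\hat I(\nu,\mu)$ and $\hat I(\phi\mu,\phi\nu)=\hat I(\mu,\nu)$ for all $\mu,\nu\in Curr(F)$, $\phi\in Out(F)$) such that for some free basis $A$ of $F$, for some $r>0$ and for every $\nu\in Curr(F)$ we have $$\hat I(n_A,\nu)=r\,I(\ell_A,\nu).$$
   Context: $\partial F$ is the hyperbolic boundary (space of ends) of $F$, and $\partial^2F=\{(\zeta,\xi):\zeta,\xi\in\partial F,\ \zeta\ne\xi\}$ with the diagonal $F$-action. $Curr(F)$ is the set of geodesic currents: positive (non-negative) locally finite $F$-invariant Borel measures on $\partial^2F$. Every $\phi\in Aut(F)$ induces a homeomorphism of $\partial^2F$; $Aut(F)$ acts on $Curr(F)$ on the left by $(\phi\nu)(S)=\nu(\phi^{-1}(S))$ for Borel $S$, and this action factors through $Out(F)$. Let $A$ be a free basis of $F$ and $X_A$ the Cayley graph of $F$ with respect to $A$ (a tree with $\partial X_A=\partial F$). For a reduced oriented edge-path $\gamma$ in $X_A$ with $|\gamma|\ge1$ edges, $Cyl_A(\gamma)$ is the set of $(x,y)\in\partial^2F$ such that the geodesic line in $X_A$ oriented from $x$ to $y$ contains $\gamma$ with agreeing orientation. The uniform current $n_A\in Curr(F)$ is determined by $n_A(Cyl_A(\gamma))=\frac{1}{2k(2k-1)^{|\gamma|-1}}$ for all such $\gamma$. $\ell_A:F\to\mathbb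 R$ is the hyperbolic length function of the action of $F$ on $X_A$, i.e. $\ell_A(g)$ is the cyclically reduced length of $g$ over $A$. The intersection form value is $$I(\ell_A,\nu)=\sum_{x\in A\cup A^{-1}}\nu(Cyl_A(e_x)),$$ where $e_x$ is any oriented edge of $X_A$ with label $x$ (by $F$-invariance of $\nu$ the choice does not matter). *)

(* Defs.v *)
From HB Require Import structures.
From mathcomp Require Import all_boot all_order all_algebra.
From mathcomp Require Import all_classical all_reals all_analysis.

Set Implicit Arguments.
Unset Strict Implicit.
Unset Printing Implicit Defensive.

Import Order.TTheory GRing.Theory Num.Theory.
Local Open Scope classical_set_scope.
Local Open Scope ring_scope.

(* The letter (i, true) stands for the i-th basis element and (i, false) for
   its inverse. *)
Notation letter k := ('I_k * bool)%type.

Definition letter_inv k (x : letter k) : letter k := (x.1, ~~ x.2).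

Definition letter_val (F : groupType) k (A : 'I_k -> F) (x : letter k) : F :=
  if x.2 then A x.1 else ((A x.1)^-1)%g.

Definition word_val (F : groupType) k (A : 'I_k -> F) (w : seq (letter k)) : F :=
  (\prod_(x <- w) letter_val A x)%g.

Definition reduced k (w : seq (letter k)) : bool :=
  sorted (fun x y : letter k => y != letter_inv x) w.

Definition free_basis (F : groupType) k (A : 'I_k -> F) : Prop :=
  forall g : F, exists! w : seq (letter k), reduced w /\ word_val A w = g.

Record freeGroup (k : nat) := FreeGroup {
  fg_sort :> groupType;
  fg_rank_ge2 : (2 <= k)%N;
  fg_free : exists A : 'I_k -> fg_sort, free_basis A }.

(* The space of ends of a finitely generated group, described without choosing
   a Cayley graph: S is almost invariant iff its coboundary in one (equivalently
   every) locally finite Cayley graph is finite, and an end is an ultrafilter,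
   without finite members, of the Boolean algebra of almost invariant sets.  The
   members of an end are the almost invariant sets that contain all vertices
   close to it. *)
Definition almost_invariant (F : groupType) (S : set F) : Prop :=
  forall g : F, finite_set [set x | ~ (S x <-> S (x * g)%g)].

Record is_end (F : groupType) (e : set (set F)) : Prop := IsEnd {
  end_ai : forall S, e S -> almost_invariant S;
  end_or : forall S, almost_invariant S -> e S \/ e (~` S);
  end_I : forall S T, e S -> e T -> e (S `&` T);
  end_infinite : forall S, e S -> infinite_set S }.

Record ends (F : groupType) := End {
  end_sets :> set (set F);
  end_setsP : is_end end_sets }.

Lemma ends_ext (F : groupType) (x y : ends F) :
  (end_sets x = end_sets y) -> x = y.
Proof.
by case: x y => [x hx] [y hy] /= xy; subst y; rewrite (Prop_irrelevance hx hy).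
Qed.

Section AlmostInvariant.
Context (F : groupType).
Implicit Types S T : set F.

Lemma almost_invariantT : almost_invariant [set: F].
Proof.
by move=> g; apply: (sub_finite_set _ (@finite_set0 F)) => x /= h; apply: h.
Qed.

Lemma almost_invariantI S T : almost_invariant S -> almost_invariant T ->
  almost_invariant (S `&` T).
Proof.
move=> hS hT g; apply: (@sub_finite_set _ _
  ([set x | ~ (S x <-> S (x * g)%g)] `|` [set x | ~ (T x <-> T (x * g)%g)])).
  move=> x /= h; apply/not_andP => -[h1 h2]; apply: h.
  by split=> -[]; split; tauto.
by rewrite finite_setU.
Qed.

Lemma almost_invariantC S : almost_invariant S -> almost_invariant (~` S).
Proof.
by move=> hS g; apply: (sub_finite_set _ (hS g)) => x /=; tauto.
Qed.

End AlmostInvariant.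

HB.instance Definition _ (F : groupType) := gen_eqMixin (ends F).
HB.instance Definition _ (F : groupType) := gen_choiceMixin (ends F).

Section EndsTopology.
Context (F : groupType).

Let b (S : set F) : set (ends F) := [set e : ends F | end_sets e S].

Let b_cover : \bigcup_(S in @almost_invariant F) b S = setT.
Proof.
apply/seteqP; split=> // e _.
exists setT; first exact: almost_invariantT.
have [//|h] := end_or (end_setsP e) (@almost_invariantT F).
by have := end_infinite (end_setsP e) h; rewrite setCT => /(_ (finite_set0 _)).
Qed.

Let b_join (S T : set F) (t : ends F) : almost_invariant S ->
    almost_invariant T -> b S t -> b T t ->
  exists U, [/\ almost_invariant U, b U t & b U `<=` b S `&` b T].
Proof.
have up (e : ends F) (U V : set F) :
    almost_invariant V -> U `<=` V -> b U e -> b V e.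
  move=> aV UV eU; have [//|h] := end_or (end_setsP e) aV.
  have := end_infinite (end_setsP e) (end_I (end_setsP e) eU h).
  suff -> : U `&` ~` V = set0 by move=> /(_ (finite_set0 _)).
  by apply/seteqP; split=> // x [/UV].
move=> aS aT tS tT; exists (S `&` T); split.
- exact: almost_invariantI.
- by rewrite /b /=; apply: (end_I (end_setsP t)).
- move=> e eST; split; last by apply: up eST => // x [].
  by apply: up eST => // x [].
Qed.

(* The sets of ends lying in a given almost invariant set are a basis of open
   sets. *)
HB.instance Definition _ :=
  @isBaseTopological.Build (ends F) (set F) (@almost_invariant F) b b_cover b_join.

End EndsTopology.

(* Maps of F that act on ends; instances are the left translations and the
   automorphisms. *)
Definition ai_iso (F : groupType) (f : F -> F) : Prop :=
  exists f' : F -> F, [/\ cancel f f', cancel f' f,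
    forall S, almost_invariant S -> almost_invariant (f @^-1` S) &
    forall S, almost_invariant S -> almost_invariant (f' @^-1` S)].

Section EndMap.
Context (F : groupType).

Lemma finite_preimage_can (f f' : F -> F) (S : set F) : cancel f f' ->
  finite_set S -> finite_set (f @^-1` S).
Proof.
move=> fK /(finite_image f'); apply: sub_finite_set => x /= Sfx.
by exists (f x).
Qed.

Lemma is_end_preimage (f : F -> F) (hf : ai_iso f) (e : ends F) :
  is_end [set S | end_sets e (f @^-1` S)].
Proof.
case: hf => f' [fK f'K cf cf']; have he := end_setsP e; split=> /= [S eS|S aS|S T|S eS].
- have := cf' _ (end_ai he eS); suff -> : f' @^-1` (f @^-1` S) = S by [].
  by apply/funext => x /=; rewrite f'K.
- exact: (end_or he (cf _ aS)).
- exact: (end_I he).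
- move=> fS; have := end_infinite he eS; apply.
  exact: (finite_preimage_can fK fS).
Qed.

Definition end_map (f : F -> F) (hf : ai_iso f) (e : ends F) : ends F :=
  End (is_end_preimage hf e).

Lemma end_map_inj f (hf : ai_iso f) : injective (end_map hf).
Proof.
move=> x y [xy]; apply: ends_ext; apply/seteqP.
have [f' [fK f'K cf cf']] := hf.
have fE S : f @^-1` (f' @^-1` S) = S by apply/funext => z /=; rewrite fK.
split=> S; rewrite -(fE S) => h.
- by have := congr1 (fun E => E (f' @^-1` S)) xy => /= <-.
- by have := congr1 (fun E => E (f' @^-1` S)) xy => /= ->.
Qed.

Lemma end_map_continuous f (hf : ai_iso f) : continuous (end_map hf).
Proof.
apply/continuousP => _ [D' sD <-].
rewrite preimage_bigcup; apply: bigcup_open => S /sD aS.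
exists [set f @^-1` S]; last by rewrite bigcup_set1.
by move=> _ ->; case: hf => f' [_ _ cf _]; exact: cf.
Qed.

Lemma ai_iso_left (g : F) : ai_iso (fun x : F => (g * x)%g).
Proof.
have c (h : F) (S : set F) :
    almost_invariant S -> almost_invariant ((fun x : F => (h * x)%g) @^-1` S).
  move=> aS u; apply: (sub_finite_set _ (finite_preimage_can (mulKg h) (aS u))).
  by move=> x /=; rewrite mulgA.
by exists (fun x => g^-1 * x)%g; split; [exact: mulKg | exact: mulVKg | exact: c | exact: c].
Qed.

End EndMap.

Record automorphism (F : groupType) := Automorphism {
  aut_fun :> {multiplicative F -> F};
  aut_bij : bijective aut_fun }.

Lemma ai_iso_aut (F : groupType) (phi : automorphism F) : ai_iso phi.
Proof.
have c (f f' : F -> F) (S : set F) : {morph f : x y / (x * y)%g} ->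
    cancel f f' -> almost_invariant S -> almost_invariant (f @^-1` S).
  move=> fM fK aS u.
  apply: (sub_finite_set _ (finite_preimage_can fK (aS (f u)))).
  by move=> x /=; rewrite fM.
have [phi' K K'] := aut_bij phi.
have phiM : {morph phi : x y / (x * y)%g} by exact: gmulfM.
exists phi'; split=> // S aS.
  exact: (c _ _ _ phiM K aS).
apply: (c _ _ _ _ K' aS) => x y.
by apply: (can_inj K); rewrite phiM !K'.
Qed.

(* Two distinct ends: the limits of a^n and a^-n for a basis element a.  Needed
   only because the library's measurable types are pointed. *)
Section TwoEnds.
Context (F : groupType) (k : nat) (A : 'I_k -> F) (x0 : letter k).
Hypothesis freeA : free_basis A.

Let val := word_val A.

Let val_cat u w : val (u ++ w) = (val u * val w)%g.
Proof. by rewrite /val /word_val big_cat. Qed.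

Let val_rcons w y : val (rcons w y) = (val w * letter_val A y)%g.
Proof. by rewrite -cats1 val_cat /val /word_val big_seq1. Qed.

Let letter_invK : involutive (@letter_inv k).
Proof. by move=> [i b]; rewrite /letter_inv /= negbK. Qed.

Let letter_valV (y : letter k) : letter_val A (letter_inv y) = ((letter_val A y)^-1)%g.
Proof. by case: y => i [] //=; rewrite /letter_val /= invgK. Qed.

Let val_inj u w : reduced u -> reduced w -> val u = val w -> u = w.
Proof.
move=> ru rw uw; have [t [_ tu]] := freeA (val w).
by rewrite -(tu u) // -(tu w).
Qed.

Let valP g : exists2 w, reduced w & val w = g.
Proof. by have [w [[rw <-] _]] := freeA g; exists w. Qed.

Let starts : set F := [set g | exists w, reduced (x0 :: w) /\ val (x0 :: w) = g].

Let startsE w : reduced w -> starts (val w) <-> ohead w = Some x0.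
Proof.
move=> rw; split; first by case=> u [ru /val_inj <-].
by case: w rw => //= y w rw [yx]; subst y; exists w.
Qed.

Let bad (g : F) := [set x | ~ (starts x <-> starts (x * g)%g)].

Let bad_letter y : finite_set (bad (letter_val A y)).
Proof.
apply: (@sub_finite_set _ _ ([set 1%g] `|` [set letter_val A (letter_inv y)])); last first.
  by rewrite finite_setU; split; exact: finite_set1.
move=> x /=; have [w rw <-] := valP x; case/lastP: w rw => [|w z] rw h.
  by left; rewrite /val /word_val big_nil.
have [zy|zy] := eqVneq y (letter_inv z); last first.
  case: h; have rwz : reduced (rcons (rcons w z) y).
    case: w rw => [|u w] rw; first by rewrite /reduced /= zy.
    by rewrite /reduced /= rcons_path last_rcons zy andbT; exact: rw.
  rewrite -val_rcons startsE // startsE //.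
  by case: (w).
have rw' : reduced w.
  by case: w rw {h} => // u w; rewrite /reduced /= rcons_path => /andP[].
case: w rw rw' h => [|u w] rw rw' h.
  by right; rewrite zy letter_invK /val /word_val big_seq1.
case: h; rewrite (startsE rw).
rewrite val_rcons zy letter_valV mulgK startsE //.
Qed.

Let starts_ai : almost_invariant starts.
Proof.
move=> g; have [w _ <-] := valP g; elim: w => [|y w IH].
  apply: (sub_finite_set _ (@finite_set0 F)) => x /=.
  by rewrite /val /word_val big_nil mulg1; apply.
apply: (@sub_finite_set _ _ (bad (letter_val A y) `|`
   (fun x : F => (x * letter_val A y)%g) @^-1` bad (val w))); last first.
  rewrite finite_setU; split; first exact: bad_letter.
  exact: (finite_preimage_can (@mulgK _ (letter_val A y)) IH).
move=> x /= h; apply/not_andP => -[h1 h2]; apply: h.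
by rewrite h1 h2 -mulgA -cat1s val_cat /val /word_val big_seq1.
Qed.

Let ray (y : letter k) (n : nat) : F := val (nseq n y).

Let reduced_nseq (y : letter k) n : reduced (nseq n y).
Proof.
have yy : y != letter_inv y by case: y => i []; apply/eqP => -[].
case: n => // n; rewrite /reduced /=.
by elim: n => //= n ->; rewrite yy.
Qed.

Let ray_inj y : injective (ray y).
Proof.
by move=> m n /val_inj /(congr1 size); rewrite !size_nseq; apply; exact: reduced_nseq.
Qed.

Let rayS y n : ray y n.+1 = (ray y n * letter_val A y)%g.
Proof. by rewrite -val_rcons /ray; congr val; elim: n => //= n ->. Qed.

Let ray_finite y (S : set F) : finite_set S ->
  exists N, forall n, (N <= n)%N -> ~ S (ray y n).
Proof.
move=> fS; have /finite_seqP[s sE] : finite_set (ray y @^-1` S).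
  apply: finite_preimage fS => m n _ _; exact: ray_inj.
exists (\max_(i <- s) i).+1 => n nN Sn.
have : n \in s by have : [set` s] n by rewrite -sE.
by move=> ns; have := @leq_bigmax_seq _ s xpredT (fun i => i) n ns isT; rewrite leqNgt nN.
Qed.

Let ray_end_sets y : set (set F) := [set S | almost_invariant S /\
  exists N, forall n, (N <= n)%N -> S (ray y n)].

Let ray_is_end y : is_end (ray_end_sets y).
Proof.
split.
- by move=> S [].
- move=> S aS; have [N hN] := ray_finite y (aS (letter_val A y)).
  have st n : (N <= n)%N -> (S (ray y N) <-> S (ray y n)).
    move=> /subnKC <-; elim: (n - N)%N => [|m IH]; first by rewrite addn0.
    have /= /contrapT := hN (N + m)%N (leq_addr _ _).
    by rewrite -rayS addnS => <-.
  have [SN|SN] := pselect (S (ray y N)); [left|right]; split => //.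
  + by exists N => n /st <-.
  + exact: almost_invariantC.
  + by exists N => n /st; rewrite /setC /= => <-.
- move=> S T [aS [M hM]] [aT [N hN]]; split; first exact: almost_invariantI.
  exists (maxn M N) => n; rewrite geq_max => /andP[/hM ? /hN ?]; by split.
- move=> S [aS [M hM]] /(ray_finite y) [N hN].
  exact: (hN (maxn M N) (leq_maxr _ _) (hM _ (leq_maxl _ _))).
Qed.

Lemma two_ends : exists p : ends F * ends F, p.1 <> p.2.
Proof.
exists (End (ray_is_end x0), End (ray_is_end (letter_inv x0))) => /= -[/=].
have : ray_end_sets x0 starts.
  split; first exact: starts_ai.
  exists 1%N => -[//|n] _; exists (nseq n x0); split=> //; exact: (reduced_nseq x0 n.+1).
move=> + E; rewrite E => -[_ [N /(_ N.+1 (leqnSn _))]].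
rewrite startsE /=; last exact: (reduced_nseq _ N.+1).
by case: (x0) => i [].
Qed.

End TwoEnds.

(* The subspace topology of the product ends F * ends F. *)
Definition dbdry k (F : freeGroup k) : Type :=
  set_type [set p : ends F * ends F | p.1 <> p.2].

HB.instance Definition _ k (F : freeGroup k) := Topological.on (dbdry F).

Lemma dbdry_nonempty k (F : freeGroup k) : exists p : dbdry F, True.
Proof.
have [A freeA] := fg_free F.
have k0 : (0 < k)%N by exact: leq_trans (fg_rank_ge2 F).
have [p hp] := two_ends (Ordinal k0, true) freeA.
have hp' : p \in [set p : ends F * ends F | p.1 <> p.2] by exact: mem_set.
by exists (SigSub hp').
Qed.

HB.instance Definition _ k (F : freeGroup k) :=
  isPointed.Build (dbdry F) (sval (cid (dbdry_nonempty F))).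

Notation borel_dbdry F := (g_sigma_algebraType (open : set (set (dbdry F)))).

Section DbdryMap.
Context (k : nat) (F : freeGroup k).

Lemma dbdry_map_subproof (f : F -> F) (hf : ai_iso f) (p : dbdry F) :
  (end_map hf (val p).1, end_map hf (val p).2) \in
    [set p : ends F * ends F | p.1 <> p.2].
Proof.
by apply: mem_set => /= /end_map_inj; exact: set_mem (valP p).
Qed.

Definition dbdry_map (f : F -> F) (hf : ai_iso f) (p : dbdry F) : dbdry F :=
  SigSub (dbdry_map_subproof hf p).

Lemma dbdry_map_continuous f (hf : ai_iso f) : continuous (dbdry_map hf).
Proof.
apply: continuous_comp_initial => p.
have cv : continuous (fun q : dbdry F => val q) := @initial_continuous _ _ set_val.
have c1 : (fun q : dbdry F => end_map hf (val q).1) @ p --> end_map hf (val p).1.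
  apply: (continuous_comp (continuous_comp (cv p) cvg_fst)).
  exact: end_map_continuous.
have c2 : (fun q : dbdry F => end_map hf (val q).2) @ p --> end_map hf (val p).2.
  apply: (continuous_comp (continuous_comp (cv p) cvg_snd)).
  exact: end_map_continuous.
exact: (cvg_pair c1 c2).
Qed.

Lemma dbdry_map_measurable f (hf : ai_iso f) :
  measurable_fun setT (dbdry_map hf : borel_dbdry F -> borel_dbdry F).
Proof.
apply: (@measurability _ _ _ (borel_dbdry F) _ _ (open : set (set (dbdry F)))) => // _ [U oU <-].
rewrite setTI; apply: sub_sigma_algebra.
by have /continuousP := @dbdry_map_continuous _ hf; exact.
Qed.

Lemma dbdry_map_borel f (hf : ai_iso f) (S : set (borel_dbdry F)) :
  measurable S -> measurable (dbdry_map hf @^-1` S : set (borel_dbdry F)).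
Proof.
by move=> mS; rewrite -[X in measurable X]setTI; exact: dbdry_map_measurable.
Qed.

Lemma dbdry_map_comp f g h (hf : ai_iso f) (hg : ai_iso g) (hh : ai_iso h) :
  f \o g =1 h -> dbdry_map hf \o dbdry_map hg =1 dbdry_map hh.
Proof.
move=> fgh p; have fgE : h = f \o g by apply/funext.
by apply: val_inj => /=; congr pair; apply: ends_ext => /=; rewrite fgE.
Qed.

Lemma dbdry_map_inv f (hf : ai_iso f) : exists2 g, cancel f g &
  exists hg : ai_iso g, cancel (dbdry_map hf) (dbdry_map hg) /\
    cancel (dbdry_map hg) (dbdry_map hf).
Proof.
have [g [fK gK cf cg]] := hf.
have hg : ai_iso g by exists f.
have hi : ai_iso (@id F) by exists id; split.
have idE : dbdry_map hi =1 id.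
  by move=> [[x y] p]; apply: val_inj => /=; congr pair; exact: ends_ext.
by exists g => //; exists hg; split=> p;
  rewrite -[LHS]/((dbdry_map _ \o dbdry_map _) p) (dbdry_map_comp _ _ hi) ?idE.
Qed.

End DbdryMap.

Lemma ai_iso_comp (F : groupType) (f g : F -> F) :
  ai_iso f -> ai_iso g -> ai_iso (f \o g).
Proof.
move=> [f' [fK f'K cf cf']] [g' [gK g'K cg cg']].
exists (g' \o f'); split; [exact: can_comp | exact: can_comp | |].
- by move=> S /cf /cg.
- by move=> S /cg' /cf'.
Qed.

Definition left_dbdry k (F : freeGroup k) (g : F) : dbdry F -> dbdry F :=
  dbdry_map (ai_iso_left g).

Definition aut_dbdry k (F : freeGroup k) (phi : automorphism F) :
    dbdry F -> dbdry F :=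
  dbdry_map (ai_iso_aut phi).

(* A library measure is a function on all sets, specified only on measurable
   ones; the value 0 imposed on the other sets makes equality of currents the
   equality of measures on Borel sets. *)
Record current (R : realType) k (F : freeGroup k) := Current {
  current_measure :> {measure set (borel_dbdry F) -> \bar R};
  current_locally_finite : forall p : dbdry F, exists U : set (dbdry F),
    [/\ open U, U p & (current_measure U < +oo)%E];
  current_invariant : forall (g : F) (S : set (borel_dbdry F)), measurable S ->
    current_measure (left_dbdry g @^-1` S) = current_measure S;
  current_nonborel : forall S : set (borel_dbdry F), ~ measurable S ->
    current_measure S = 0%E }.

Lemma current_ext (R : realType) k (F : freeGroup k) (mu nu : current R F) :
  (forall S : set (borel_dbdry F), measurable S -> mu S = nu S) -> mu = nu.
Proof.
move=> h; have E : current_measure mu = current_measure nu.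
  apply: eq_measure; apply/funext => S; have [mS|nS] := pselect (measurable S).
    exact: h.
  by rewrite !current_nonborel.
case: mu nu E {h} => [m a b c] [n a' b' c'] /= E; subst n.
by rewrite (Prop_irrelevance a a') (Prop_irrelevance b b') (Prop_irrelevance c c').
Qed.

Section AutCurrent.
Context (R : realType) (k : nat) (F : freeGroup k).
Variables (phi : automorphism F) (nu : current R F).

Let f : borel_dbdry F -> borel_dbdry F := aut_dbdry phi.

Let mf : measurable_fun setT f := dbdry_map_measurable (ai_iso_aut phi).

Definition aut_measure : {measure set (borel_dbdry F) -> \bar R} :=
  measure_function_pushforward__canonical__measure_function_Measure nu mf.

Lemma aut_measureE (S : set (borel_dbdry F)) :
  aut_measure S = nu (aut_dbdry phi @^-1` S).
Proof. by []. Qed.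

Lemma aut_measure_locally_finite (p : dbdry F) : exists U : set (dbdry F),
  [/\ open U, U p & (aut_measure U < +oo)%E].
Proof.
have [g _ [hg [fK gK]]] := dbdry_map_inv (ai_iso_aut phi).
have [U [oU Up Uoo]] := current_locally_finite nu (dbdry_map hg p).
exists (dbdry_map hg @^-1` U); split => //.
  by have /continuousP := @dbdry_map_continuous _ _ _ hg; exact.
rewrite aut_measureE (_ : _ @^-1` _ = U) //.
by apply/funext => q /=; rewrite /aut_dbdry fK.
Qed.

Lemma aut_measure_invariant (g : F) (S : set (borel_dbdry F)) : measurable S ->
  aut_measure (left_dbdry g @^-1` S) = aut_measure S.
Proof.
move=> mS; rewrite !aut_measureE; have [psi _ psiK] := aut_bij phi.
rewrite -(current_invariant nu (psi g) (dbdry_map_borel (ai_iso_aut phi) mS)).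
congr (nu _); apply/funext => p /=; congr S.
have h : ai_iso (fun x : F => (g * phi x)%g).
  by apply: ai_iso_comp; [exact: ai_iso_left | exact: ai_iso_aut].
rewrite /left_dbdry /aut_dbdry.
rewrite -[LHS]/((dbdry_map _ \o dbdry_map _) p) -[RHS]/((dbdry_map _ \o dbdry_map _) p).
rewrite !(@dbdry_map_comp _ _ _ _ _ _ _ h) // => x /=.
by rewrite gmulfM psiK.
Qed.

Lemma aut_measure_nonborel (S : set (borel_dbdry F)) : ~ measurable S ->
  aut_measure S = 0%E.
Proof.
move=> nS; rewrite aut_measureE; apply: current_nonborel => mS; apply: nS.
have [g _ [hg [fK gK]]] := dbdry_map_inv (ai_iso_aut phi).
have := dbdry_map_borel hg mS; congr (measurable _).
by apply/funext => q /=; rewrite /aut_dbdry gK.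
Qed.

Definition aut_current : current R F :=
  Current aut_measure_locally_finite aut_measure_invariant aut_measure_nonborel.

End AutCurrent.

(* Automorphisms in the same outer class act in the same way, so that Out(F) acts
   on currents and Out(F)-equivariance is equivariance under all automorphisms. *)
Lemma aut_current_outer (R : realType) k (F : freeGroup k)
    (phi psi : automorphism F) (g : F) (nu : current R F) :
  (forall x : F, psi x = (g * phi x * g^-1)%g) ->
  aut_current psi nu = aut_current phi nu.
Proof.
move=> psiE.
have diff (e : ends F) (S T : set F) : almost_invariant T ->
    finite_set [set x | ~ (S x <-> T x)] -> end_sets e S -> end_sets e T.
  move=> aT fST eS; have [//|eT] := end_or (end_setsP e) aT.
  case: (end_infinite (end_setsP e) (end_I (end_setsP e) eS eT)).
  by apply: (sub_finite_set _ fST) => x [/= Sx Tx] [/(_ Sx)].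
have endE (e : ends F) : end_map (ai_iso_aut psi) e =
    end_map (ai_iso_left g) (end_map (ai_iso_aut phi) e).
  have pre (S : set F) : almost_invariant S ->
      almost_invariant (psi @^-1` S) /\
      almost_invariant (phi @^-1` ((fun x : F => (g * x)%g) @^-1` S)).
    have [f' [_ _ cf _]] := ai_iso_aut psi.
    have [h' [_ _ ch _]] := ai_iso_comp (ai_iso_left g) (ai_iso_aut phi).
    by move=> aS; split; [exact: cf | exact: ch].
  have fin (S : set F) : almost_invariant S ->
      finite_set [set x | ~ (S (psi x) <-> S (g * phi x)%g)].
    move=> aS; have [h' [hK _ _ _]] := ai_iso_comp (ai_iso_left g) (ai_iso_aut phi).
    apply: (sub_finite_set _ (finite_preimage_can hK (aS (g^-1)%g))) => x /=.
    by rewrite psiE; tauto.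
  apply: ends_ext; apply/seteqP; split=> S eS.
  - have aS := end_ai (end_setsP (end_map (ai_iso_aut psi) e)) eS.
    by apply: (diff e (psi @^-1` S) _ _ _ eS); [exact: (pre _ aS).2 | exact: fin].
  - have aS := end_ai (end_setsP (end_map (ai_iso_left g)
      (end_map (ai_iso_aut phi) e))) eS.
    apply: (diff e (fun x : F => S (g * phi x)%g) _ _ _ eS); first exact: (pre _ aS).1.
    by apply: (sub_finite_set _ (fin _ aS)) => x /=; tauto.
apply: current_ext => S mS /=; rewrite -[RHS](aut_measure_invariant phi nu g mS).
rewrite !aut_measureE; congr (nu _); apply/funext => p /=; congr S.
by apply: val_inj => /=; rewrite !endE.
Qed.

Section Cylinders.
Context (F : groupType) (k : nat) (A : 'I_k -> F).

(* Vertices of the Cayley graph X_A are the elements of F; an oriented edge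
   labelled x goes from g to g * x.  A geodesic line is given by its vertices:
   consecutive ones are adjacent, and no word of length < n leads from l m to
   l (m + n). *)
Definition geodesic_line (l : int -> F) : Prop :=
  (forall m : int, exists x : letter k, l (m + 1) = (l m * letter_val A x)%g) /\
  (forall (m : int) (n : nat) (w : seq (letter k)),
     l (m + n%:Z) = (l m * word_val A w)%g -> (n <= size w)%N).

Definition converges_to (v : nat -> F) (x : ends F) : Prop :=
  forall S, end_sets x S -> exists N : nat, forall n : nat, (N <= n)%N -> S (v n).

Definition line_from_to (l : int -> F) (x y : ends F) : Prop :=
  [/\ geodesic_line l, converges_to (fun n => l (- n%:Z)) x &
      converges_to (fun n => l n%:Z) y].

(* The edge-path w starts at the vertex g and is traversed in its own direction. *)
Definition contains_path (l : int -> F) (g : F) (w : seq (letter k)) : Prop :=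
  exists m : int, forall i : nat, (i <= size w)%N ->
    l (m + i%:Z) = (g * word_val A (take i w))%g.

End Cylinders.

Section Currents.
Context (R : realType) (k : nat) (F : freeGroup k) (A : 'I_k -> F).

Definition Cyl (g : F) (w : seq (letter k)) : set (dbdry F) :=
  [set p | exists l : int -> F,
     line_from_to A l (val p).1 (val p).2 /\ contains_path A l g w].

Definition uniform_current (nu : current R F) : Prop :=
  forall (g : F) (w : seq (letter k)), reduced w -> (1 <= size w)%N ->
    nu (Cyl g w) = ((2 * k%:R * (2 * k%:R - 1) ^+ (size w).-1)^-1)%:E.

(* I(l_A, nu), with e_x the edge from 1 to x. *)
Definition intersection_form (nu : current R F) : \bar R :=
  (\sum_(x : letter k) nu (Cyl 1%g [:: x]))%E.

End Currents.

(* Main.v *)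
(* Symmetry and equivariance give I(l_A, phi n_A) = I(l_A, phi^-1 n_A) for every
   automorphism phi, and this fails for phi : a |-> ababa, b |-> ba, with the
   other basis elements fixed.

   To compute I(l_A, phi n_A), associate with an oriented edge e of X_A the
   function d_e on pairs of ends whose value is 1, -1 or 0 according to whether
   the line traverses e, its reverse, or neither.  If e_x is the edge from 1 to x,
   then d_{e_x} o phi is the signed sum of the d_e over the occurrences of x and
   x^-1 in the words phi(z): both sides have the same differences along the edges
   of X_A.  The product d_e d_e' is, up to sign, the indicator of the two
   cylinders of the geodesic spanned by e and e', so its n_A-integral depends only
   on the length of that geodesic.  Hence the integral of (d_{e_x} o phi)^2, which
   is the contribution of x and x^-1 to I(l_A, phi n_A), is an explicit finite
   sum.  With t = 2k - 1 the values for phi and phi^-1 differ by a nonzero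
   multiple of 6t^3 - 16t^2 - 2, which is positive for t >= 3. *)
Require Import Defs.
From HB Require Import structures.
From mathcomp Require Import all_boot all_order all_algebra.
From mathcomp Require Import all_classical all_reals all_analysis.
From mathcomp Require Import measurable_realfun ring lra zify.

Set Implicit Arguments.
Unset Strict Implicit.
Unset Printing Implicit Defensive.

Import Order.TTheory GRing.Theory Num.Theory.
Local Open Scope classical_set_scope.
Local Open Scope ring_scope.

(** * Reduced words and half-trees of the Cayley graph *)

Section Words.
Context (k : nat).
Implicit Types (x y z : letter k) (u v w : seq (letter k)).

Lemma letter_invK : involutive (@letter_inv k).
Proof. by move=> [i b]; rewrite /letter_inv /= negbK. Qed.

Lemma letter_inv_neq x : letter_inv x != x.
Proof. by case: x => i [] /=; apply/eqP => -[]. Qed.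

Lemma letter_inv_eq x y : (letter_inv x == y) = (x == letter_inv y).
Proof. by apply/eqP/eqP => [<-|->]; rewrite letter_invK. Qed.

Definition word_inv w := rev (map (@letter_inv k) w).

Definition rcancel x w :=
  if w is y :: w' then if y == letter_inv x then w' else x :: w else [:: x].

Definition reduce w := foldr rcancel [::] w.

Lemma reduced_cons x w :
  reduced (x :: w) = (ohead w != Some (letter_inv x)) && reduced w.
Proof. by case: w => //= y w. Qed.

Lemma reduced_rcons w y :
  reduced (rcons w y) = reduced w && (ohead (rev w) != Some (letter_inv y)).
Proof.
case: w => //= x w; rewrite /reduced /= rcons_path; congr (_ && _).
case/lastP: w => [|w z]; rewrite -?rcons_cons ?last_rcons ?rev_rcons /=;
  by rewrite -letter_inv_eq eq_sym.
Qed.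

Lemma reduced_rcancel x w : reduced w -> reduced (rcancel x w).
Proof.
case: w => // y w; rewrite /rcancel; case: eqP => [_|/eqP yx] yw.
  by move: yw; rewrite reduced_cons => /andP[].
by rewrite reduced_cons yw andbT; apply: contraNneq yx => -[->].
Qed.

Lemma reduced_reduce w : reduced (reduce w).
Proof. by elim: w => // x w; exact: reduced_rcancel. Qed.

Lemma reduce_id w : reduced w -> reduce w = w.
Proof.
elim: w => // x w IH; rewrite reduced_cons => /andP[xw /IH /= ->].
by case: {IH} w xw => //= y w xw; case: eqP => // yx; rewrite yx eqxx in xw.
Qed.

Lemma size_reduce w : (size (reduce w) <= size w)%N.
Proof.
elim: w => //= x w; case: (reduce w) => //= y u.
by case: ifP => //= _; lia.
Qed.

Lemma reduced_cat u v : reduced (u ++ v) -> reduced u /\ reduced v.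
Proof.
elim: u => [//|x u IH]; rewrite cat_cons !reduced_cons => /andP[xu /IH[-> ->]].
by rewrite andbT; split=> //; case: u xu {IH}.
Qed.

(** Reducedness concerns adjacent letters only, so words overlapping in [y] can be glued. *)
Lemma reduced_cat_cons u y v :
  reduced (rcons u y) -> reduced (y :: v) -> reduced (u ++ y :: v).
Proof.
move=> + yv; elim: u => [//|x u IH]; rewrite rcons_cons cat_cons !reduced_cons => /andP[xu /IH ->].
by rewrite andbT; case: u xu {IH}.
Qed.

Lemma reduced_inv w : reduced w -> reduced (word_inv w).
Proof.
elim: w => // x w IH; rewrite reduced_cons => /andP[xw /IH rw].
rewrite /word_inv /= rev_cons reduced_rcons rw revK letter_invK /=.
case: w xw {IH rw} => //= y w yx.
by apply: contraNneq yx => -[<-]; rewrite letter_invK.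
Qed.

Lemma reduced_mkseq (f : nat -> letter k) n :
  (forall i, f i.+1 != letter_inv (f i)) -> reduced (mkseq f n).
Proof.
move=> fS; elim: n => // n IH; rewrite mkseqS reduced_rcons IH /=.
case: n {IH} => // n; rewrite mkseqS rev_rcons /=.
by apply: contraNneq (fS n) => -[->]; rewrite letter_invK.
Qed.

Section Val.
Context (F : groupType) (A : 'I_k -> F).
Local Notation val := (word_val A).

Lemma letter_valV x : letter_val A (letter_inv x) = ((letter_val A x)^-1)%g.
Proof. by case: x => i [] //=; rewrite /letter_val /= invgK. Qed.

Lemma word_val0 : val [::] = 1%g.
Proof. by rewrite /word_val big_nil. Qed.

Lemma word_val_cons x w : val (x :: w) = (letter_val A x * val w)%g.
Proof. by rewrite /word_val big_cons. Qed.

Lemma word_val1 x : val [:: x] = letter_val A x.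
Proof. by rewrite /word_val big_seq1. Qed.

Lemma word_val_cat u w : val (u ++ w) = (val u * val w)%g.
Proof. by rewrite /word_val big_cat. Qed.

Lemma word_val_rcons w y : val (rcons w y) = (val w * letter_val A y)%g.
Proof. by rewrite -cats1 word_val_cat word_val1. Qed.

Lemma word_val_inv w : val (word_inv w) = ((val w)^-1)%g.
Proof.
elim: w => [|x w IH]; first by rewrite /word_inv /= word_val0 invg1.
by rewrite /word_inv /= rev_cons word_val_rcons IH word_val_cons invgM letter_valV.
Qed.

Lemma word_val_reduce w : val (reduce w) = val w.
Proof.
elim: w => // x w /=; rewrite word_val_cons => <-.
case: (reduce w) => [|y u]; first by rewrite word_val0 mulg1 /= word_val1.
rewrite /rcancel; case: eqP => [->|_]; last by rewrite word_val_cons.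
by rewrite word_val_cons letter_valV mulVKg.
Qed.

(** The right-hand side evaluates [w] on another family of group elements, so by [word_val_reduce]
    it survives reduction of [w]. This makes substitution well defined on the group. *)
Lemma word_val_subst (B : 'I_k -> seq (letter k)) w :
  val (flatten [seq if x.2 then B x.1 else word_inv (B x.1) | x <- w]) =
  word_val (fun i => val (B i)) w.
Proof.
elim: w => [|[i []] w IH] /=; first by rewrite /word_val !big_nil.
- by rewrite word_val_cat IH [RHS]/word_val big_cons.
- by rewrite word_val_cat IH word_val_inv [RHS]/word_val big_cons.
Qed.

End Val.
End Words.

(** * Normal forms in a free group, and half-trees as almost invariant sets *)

Section NormalForm.
Context (F : groupType) (k : nat) (A : 'I_k -> F) (freeA : free_basis A).
Local Notation val := (word_val A).
Local Notation lval := (letter_val A).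
Implicit Types (x y z : letter k) (u v w : seq (letter k)) (g h : F).

Definition nf g : seq (letter k) := sval (cid (freeA g)).

Lemma reduced_nf g : reduced (nf g).
Proof. by rewrite /nf; case: cid => w [[]]. Qed.

Lemma nfK g : val (nf g) = g.
Proof. by rewrite /nf; case: cid => w [[]]. Qed.

Lemma word_val_inj u w : reduced u -> reduced w -> val u = val w -> u = w.
Proof.
move=> ru rw uw; have [t [_ tu]] := freeA (val w).
by rewrite -(tu u) // -(tu w).
Qed.

Lemma nf_val w : nf (val w) = reduce w.
Proof.
apply: word_val_inj; rewrite ?reduced_nf ?reduced_reduce //.
by rewrite nfK word_val_reduce.
Qed.

Lemma nf_reduced w : reduced w -> nf (val w) = w.
Proof. by move=> rw; rewrite nf_val reduce_id. Qed.

Lemma nf1 : nf 1%g = [::].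
Proof. by rewrite -(word_val0 A) nf_val. Qed.

Lemma nf_lmul x g : nf (lval x * g)%g = rcancel x (nf g).
Proof. by rewrite -{1}(nfK g) -word_val_cons nf_val /= reduce_id // reduced_nf. Qed.

Lemma letter_val_neq1 x : lval x != 1%g.
Proof.
apply/eqP => x1; have : nf (val [:: x]) = nf 1%g by rewrite word_val1 x1.
by rewrite nf_reduced // nf1.
Qed.

(* The half-tree of the Cayley graph seen from g through the edge labelled x. *)
Definition half_tree g x : set F := [set h | ohead (nf (g^-1 * h)%g) = Some x].

Lemma half_tree_mull g h x :
  (fun f : F => (g * f)%g) @^-1` half_tree (g * h) x = half_tree h x.
Proof. by apply/funext => f; rewrite /half_tree /= invgM -mulgA mulKg. Qed.

Lemma half_treeP g x h : half_tree g x h <->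
  exists2 t, reduced (x :: t) & h = (g * val (x :: t))%g.
Proof.
split=> [|[t rt ->]]; last by rewrite /half_tree /= mulKg nf_reduced.
rewrite /half_tree /= -{2}(mulVKg g h) -{2}(nfK (g^-1 * h)%g).
have := reduced_nf (g^-1 * h)%g; case: (nf _) => // y t + [yx].
by rewrite yx => rt; exists t.
Qed.

(** Removing an edge cuts the tree in two. Seen from the far endpoint, a normal form starting with
    [x] loses that letter, and every other one gains [letter_inv x] in front. *)
Lemma half_treeC g x : half_tree (g * lval x)%g (letter_inv x) = ~` half_tree g x.
Proof.
apply/funext => h; rewrite /half_tree /= /setC /=.
rewrite invgM -mulgA -letter_valV nf_lmul.
have := reduced_nf (g^-1 * h)%g; case: (nf _) => [|y w].
  by move=> _; apply/propext; split.
rewrite reduced_cons /rcancel letter_invK; case: (y =P x) => [->|yx].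
  move=> /andP[/eqP xw _]; apply/propext; split => // /= h0; exfalso; exact: h0.
by move=> _; apply/propext; split=> // _ [].
Qed.

Lemma half_tree_sub g u y : reduced (rcons u y) ->
  half_tree (g * val u)%g y `<=` half_tree g (head y u).
Proof.
move=> ruy _ /half_treeP[t rt ->]; rewrite /half_tree /=.
rewrite -mulgA mulKg -word_val_cat nf_reduced ?reduced_cat_cons //.
by case: (u).
Qed.

(* Right multiplication by a letter is a step along an edge; the shadow changes
   only across the edge that defines it. *)
Lemma half_tree_step (R : numDomainType) g x h y :
  ((h * lval y)%g \in half_tree g x)%:R - (h \in half_tree g x)%:R =
  ((h == g) && (y == x))%:R - ((h == g * lval x)%g && (y == letter_inv x))%:R :> R.
Proof.
have inE f : (f \in half_tree g x) = (ohead (nf (g^-1 * f)%g) == Some x).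
  by apply/idP/eqP => [/set_mem|/mem_set].
have -> : (h == g) = ((g^-1 * h)%g == 1%g).
  by rewrite -(inj_eq (mulgI g^-1%g) h) mulVg.
have -> : (h == g * lval x)%g = ((g^-1 * h)%g == lval x).
  by rewrite -(inj_eq (mulgI g^-1%g) h) mulKg.
rewrite !inE mulgA; set f := (g^-1 * h)%g.
have rf := reduced_nf f; rewrite -(nfK f); move: rf; set w := nf f.
(* The letter [y] either cancels the last letter [z] or lengthens the word; the first letter changes
   only between the empty word and a word of length one. *)
case/lastP: w => [|w z] rw.
  rewrite word_val0 mul1g -word_val1 nf_reduced //= nf1 eqxx /=.
  rewrite [1%g == _]eq_sym (negbTE (letter_val_neq1 x)) /= !subr0.
  by congr ((_ : bool)%:R); apply/eqP/eqP => [[]|->].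
have zx : (val (rcons w z) == lval x) = (rcons w z == [:: x]).
  apply/eqP/eqP => [|->]; last exact: word_val1.
  by rewrite -word_val1; apply: word_val_inj.
have -> : (val (rcons w z) == 1%g) = false.
  apply/eqP => e; have : nf (val (rcons w z)) = [::] by rewrite e nf1.
  by rewrite nf_reduced //; case: (w).
rewrite zx [nf (val (rcons w z))]nf_reduced //=.
have [yz|yz] := eqVneq y (letter_inv z).
  have rw' : reduced w by move: rw; rewrite reduced_rcons => /andP[].
  rewrite yz letter_valV word_val_rcons mulgK nf_reduced // letter_inv_eq letter_invK.
  case: w {rw zx} rw' => [|u w] _ /=.
    by rewrite eqseq_cons andbT andbb.
  by rewrite subrr eqseq_cons; case: (w) => *; rewrite /= ?andbF subr0.
have rwz : reduced (rcons (rcons w z) y).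
  by rewrite reduced_rcons rw rev_rcons /=; apply: contraNneq yz => -[->]; rewrite letter_invK.
rewrite -word_val_rcons nf_reduced //.
have -> : ohead (rcons (rcons w z) y) = ohead (rcons w z) by case: (w).
rewrite subrr; case: eqP => [e|_]; last by rewrite subr0.
have zxE : z = x by case: (w) e => [|? []] //= [].
by rewrite -zxE (negbTE yz) subr0.
Qed.

(** If a step by [y :: w] changes membership, then so does the step by [y] or the subsequent step by
    [w]; both happen at finitely many places. *)
Lemma almost_invariant_letters (S : set F) :
  (forall x, finite_set [set h | ~ (S h <-> S (h * lval x)%g)]) ->
  almost_invariant S.
Proof.
move=> fS g; rewrite -(nfK g); elim: (nf g) => [|y w IH].
  by apply: (sub_finite_set _ (@finite_set0 F)) => h /=; rewrite word_val0 mulg1; apply.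
apply: (@sub_finite_set _ _ ([set h | ~ (S h <-> S (h * lval y)%g)] `|`
   (fun h : F => (h * lval y)%g) @^-1` [set h | ~ (S h <-> S (h * val w)%g)])).
  move=> h /= n; apply/not_andP => -[h1 h2]; apply: n.
  by rewrite h1 h2 word_val_cons mulgA.
rewrite finite_setU; split=> //.
exact: (finite_preimage_can (@mulgK _ (lval y)) IH).
Qed.

Lemma half_tree_almost_invariant g x : almost_invariant (half_tree g x).
Proof.
apply: almost_invariant_letters => y.
apply: (@sub_finite_set _ _ ([set g] `|` [set (g * lval x)%g])).
  move=> h /= n; apply: contrapT => /not_orP[/eqP/negbTE hg /eqP/negbTE hx]; apply: n.
  have := half_tree_step int g x h y; rewrite hg hx /= subrr => /eqP.
  rewrite subr_eq0 eqr_nat; have := in_setE (half_tree g x) h.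
  have := in_setE (half_tree g x) (h * lval y)%g => <- <-.
  by case: (_ \in _); case: (_ \in _).
by rewrite finite_setU; split; exact: finite_set1.
Qed.

End NormalForm.

(** * Ends and rays *)

Section Ends.
Context (F : groupType).
Implicit Types (e : ends F) (S T : set F).

Lemma end_setT e : end_sets e setT.
Proof.
have [//|h] := end_or (end_setsP e) (@almost_invariantT F).
by have := end_infinite (end_setsP e) h; rewrite setCT => /(_ (finite_set0 _)).
Qed.

Lemma end_nonempty e S : end_sets e S -> exists g, S g.
Proof.
move=> eS; apply: contrapT => nS; apply: (end_infinite (end_setsP e) eS).
suff -> : S = set0 by exact: finite_set0.
by apply/seteqP; split=> // g Sg; apply: nS; exists g.
Qed.

Lemma end_setC e S : almost_invariant S -> end_sets e (~` S) <-> ~ end_sets e S.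
Proof.
move=> aS; split=> [eC eS|nS]; last by case: (end_or (end_setsP e) aS).
by have [g [Sg]] := end_nonempty (end_I (end_setsP e) eS eC).
Qed.

Lemma end_up e S T : almost_invariant T -> S `<=` T -> end_sets e S -> end_sets e T.
Proof.
move=> aT ST eS; apply: contrapT => /(end_setC e aT) eT.
by have [g [/ST]] := end_nonempty (end_I (end_setsP e) eS eT).
Qed.

Section EndIndicator.
Context (R : numDomainType).

Definition end_ind e S : R := `[< end_sets e S >]%:R.

Lemma end_indC e S : almost_invariant S -> end_ind e (~` S) = 1 - end_ind e S.
Proof.
move=> aS; rewrite /end_ind; have -> : `[< end_sets e (~` S) >] = ~~ `[< end_sets e S >].
  by rewrite (asbool_equiv_eq (end_setC e aS)) asbool_neg.
by case: asbool; rewrite ?subrr ?subr0.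
Qed.

(* An end is a limit of elements of F, so linear relations between indicator
   functions of almost invariant sets on F persist at the end. *)
Lemma end_ind_relation e (I : Type) (s : seq I) (c : I -> R) (S : I -> set F) (c0 : R) :
  (forall i, almost_invariant (S i)) ->
  (forall g, \sum_(i <- s) c i * (g \in S i)%:R = c0) ->
  \sum_(i <- s) c i * end_ind e (S i) = c0.
Proof.
move=> aS rel.
suff [T eT TP] : exists2 T, end_sets e T & forall g, T g ->
    \sum_(i <- s) c i * (g \in S i)%:R = \sum_(i <- s) c i * end_ind e (S i).
  by have [g /TP <-] := end_nonempty eT.
elim: s {rel} => [|i s [T eT TP]].
  by exists setT; [exact: end_setT | move=> g _; rewrite !big_nil].
have [U eU UP] : exists2 U, end_sets e U & forall g, U g -> (g \in S i) = `[< end_sets e (S i) >].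
  have [eS|/(end_setC e (aS i)) eS] := pselect (end_sets e (S i)).
    by exists (S i) => // g Sg; rewrite mem_set ?asboolT.
  exists (~` S i) => // g Sg; rewrite memNset // asboolF //.
  exact/(end_setC e (aS i)).
exists (U `&` T); first exact: (end_I (end_setsP e)).
by move=> g [/UP Ug /TP E]; rewrite !big_cons E Ug.
Qed.

End EndIndicator.
End Ends.

Section Rays.
Context (F : groupType) (k : nat) (A : 'I_k -> F) (freeA : free_basis A).
Local Notation lval := (letter_val A).
Local Notation val := (word_val A).
Local Notation half_tree := (half_tree freeA).
Local Notation nf := (nf freeA).
Implicit Types (e : ends F) (g h v : F) (x y z : letter k).

(** The half-trees at [v] are finitely many and miss only [v]. If none belonged to [e], intersecting
    their complements would give a finite member. *)
Lemma end_half_tree e v : exists z, end_sets e (half_tree v z).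
Proof.
apply: contrapT => /forallNP none.
have [s sE] : exists s : seq (letter k), forall z, z \in s.
  by exists (enum {: letter k}) => z; rewrite mem_enum.
suff [T eT TP] : exists2 T, end_sets e T & forall g, T g -> {in s, forall z, ~ half_tree v z g}.
  apply: (end_infinite (end_setsP e) eT).
  apply: (sub_finite_set _ (finite_set1 v)) => g /TP gs /=.
  rewrite -[g](mulVKg v) -(nfK freeA (v^-1 * g)%g).
  case E : (nf (v^-1 * g)%g) => [|z w]; first by rewrite word_val0 mulg1.
  by case: (gs z (sE z)); rewrite /half_tree /= E.
elim: s {sE} => [|z s [T eT TP]]; first by exists setT; [exact: end_setT|].
exists (~` half_tree v z `&` T).
  apply: (end_I (end_setsP e)) => //.
  by apply/end_setC; [exact: half_tree_almost_invariant|exact: none].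
by move=> g [gz /TP gs] y; rewrite inE => /orP[/eqP ->|/gs].
Qed.

(** The label of the first edge from [v] towards [e]; by [dir_uniq] the choice is forced. *)
Definition dir e v : letter k := sval (cid (end_half_tree e v)).

Lemma dirP e v : end_sets e (half_tree v (dir e v)).
Proof. by rewrite /dir; case: cid. Qed.

Lemma dir_uniq e v z : end_sets e (half_tree v z) -> dir e v = z.
Proof.
move=> ez; have [g [/= h1 h2]] := end_nonempty (end_I (end_setsP e) (dirP e v) ez).
by move: h1 h2; rewrite /half_tree /= => -> [].
Qed.

Fixpoint ray e v n : F :=
  if n is n'.+1 then (ray e v n' * lval (dir e (ray e v n')))%g else v.

Lemma end_half_tree_inv e v z :
  end_sets e (half_tree (v * lval z)%g (letter_inv z)) <-> ~ end_sets e (half_tree v z).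
Proof. by rewrite half_treeC end_setC //; exact: half_tree_almost_invariant. Qed.

Lemma dir_ray e v n : dir e (ray e v n.+1) != letter_inv (dir e (ray e v n)).
Proof.
apply/eqP => dn; have := dirP e (ray e v n.+1); rewrite dn /= => /end_half_tree_inv.
by apply; exact: dirP.
Qed.

Lemma ray_word e v n : ray e v n = (v * val (mkseq (fun i => dir e (ray e v i)) n))%g.
Proof.
elim: n => [|n IH]; first by rewrite word_val0 mulg1.
by rewrite mkseqS word_val_rcons mulgA -IH.
Qed.

Lemma half_tree_ray_size e v n h :
  half_tree (ray e v n) (dir e (ray e v n)) h -> (n < size (nf (v^-1 * h)%g))%N.
Proof.
set d := fun i => dir e (ray e v i).
have rd m : reduced (mkseq d m) by apply: reduced_mkseq => i; exact: dir_ray.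
move=> /half_treeP[t]; rewrite -/(d n) ray_word -/d => rt ->.
rewrite -mulgA mulKg -word_val_cat nf_reduced; last first.
  by apply: reduced_cat_cons => //; rewrite -mkseqS.
by rewrite size_cat size_mkseq /=; lia.
Qed.

(** The coboundary of a member [S] is finite, so [S] is constant on a half-tree far along the ray.
    Both sets belong to [e], hence they meet and [S] contains that half-tree. *)
Lemma ray_converges e v : converges_to (ray e v) e.
Proof.
move=> S eS; have aS := end_ai (end_setsP e) eS.
pose bad := \bigcup_(x : letter k) [set h | ~ (S h <-> S (h * lval x)%g)].
have fbad : finite_set bad by apply: bigcup_finite => // x _; exact: aS.
have [N hN] : exists N, forall h, bad h -> (size (nf (v^-1 * h)%g) <= N)%N.
  have /finite_seqP[s sE] := fbad; exists (\max_(h <- s) size (nf (v^-1 * h)%g))%N => h.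
  by rewrite sE => hs; exact: leq_bigmax_seq.
(* Vertex [n.+1] of the ray is the root of the half-tree entered from vertex [n]. *)
exists N.+1 => -[//|n]; rewrite ltnS => Nn.
set u := ray e v n; set z := dir e u.
have good h : half_tree u z h -> forall x, S h <-> S (h * lval x)%g.
  move=> /half_tree_ray_size nh x; apply: contrapT => Sx.
  by have := hN h (ex_intro2 _ _ x I Sx); lia.
have [h [Sh hz]] := end_nonempty (end_I (end_setsP e) eS (dirP e u)).
rewrite /= -/u -/z; move: hz Sh => /half_treeP[t + ->].
(* Deleting last letters walks from [h] back to the root without leaving the half-tree. *)
elim/last_ind: t => [|t y IH]; first by rewrite word_val1.
rewrite -rcons_cons reduced_rcons => /andP[rt _]; rewrite word_val_rcons mulgA => Sh.
apply: IH => //; apply/(good _ _ y) => //.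
by apply/half_treeP; exists t.
Qed.

End Rays.

(** * Cylinders as rectangles *)

Section Lines.
Context (F : groupType) (k : nat) (A : 'I_k -> F) (freeA : free_basis A).
Local Notation lval := (letter_val A).
Local Notation val := (word_val A).
Local Notation half_tree := (half_tree freeA).
Local Notation dir := (dir freeA).
Local Notation ray := (ray freeA).
Implicit Types (e : ends F) (g h v : F) (x y z : letter k) (l : int -> F).

Lemma half_tree_stable v z h y :
  (h = v -> h * lval y <> v * lval z)%g -> (h = v * lval z -> h * lval y <> v)%g ->
  half_tree v z (h * lval y)%g <-> half_tree v z h.
Proof.
move=> h1 h2; have := half_tree_step freeA int v z h y.
have -> : (h == v) && (y == z) = false.
  by apply/andP => -[/eqP hv /eqP yz]; apply: (h1 hv); rewrite hv yz.
have -> : (h == v * lval z)%g && (y == letter_inv z) = false.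
  by apply/andP => -[/eqP hv /eqP yz]; apply: (h2 hv); rewrite hv yz letter_valV mulgK.
rewrite subrr => /eqP; rewrite subr_eq0 eqr_nat.
rewrite -(in_setE (half_tree v z) h) -(in_setE (half_tree v z) (h * lval y)%g).
by case: (_ \in _); case: (_ \in _).
Qed.

Lemma geodesic_line_inj l : geodesic_line A l -> injective l.
Proof.
move=> [_ geo].
have ltP i j : (i <= j)%R -> l i = l j -> i = j.
  move=> ij lij; have [n jE] : exists n : nat, j = i + n%:Z by exists `|j - i|%N; lia.
  have := geo i n [::]; rewrite word_val0 mulg1 -jE lij => /(_ erefl) /=; lia.
by move=> i j lij; case: (leP i j) => [|/ltW] /ltP h; [|symmetry]; apply: h.
Qed.

(** An injective line cannot cross the edge a second time, so by [half_tree_stable] each half stays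
    on its side. *)
Lemma geodesic_line_half_tree l (m : int) v z : geodesic_line A l ->
  l m = v -> l (m + 1) = (v * lval z)%g ->
  forall n : nat, half_tree v z (l (m + 1 + n%:Z)) /\ ~ half_tree v z (l (m - n%:Z)).
Proof.
move=> geo lm lm1; have linj := geodesic_line_inj geo; have [adj _] := geo.
elim=> [|n [IH1 IH2]].
  rewrite addr0 subr0 lm1 lm; split; first by apply/half_treeP; exists [::]; rewrite ?word_val1.
  by rewrite /half_tree /= mulVg nf1.
split.
  have -> : m + 1 + n.+1%:Z = m + 1 + n%:Z + 1 by lia.
  have [y yE] := adj (m + 1 + n%:Z); rewrite yE.
  apply/half_tree_stable => //; rewrite -?yE -lm1 -lm => /linj h; first by lia.
  by move=> /linj; lia.
have [y] := adj (m - n.+1%:Z); have -> : m - n.+1%:Z + 1 = m - n%:Z by lia.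
move=> yE hn; apply: IH2; rewrite yE.
apply/half_tree_stable => //; rewrite -?yE -lm1 -lm => /linj h; first by lia.
by lia.
Qed.

Section Construct.
Variables (e1 e2 : ends F) (g : F) (x : letter k).
Hypotheses (e1x : ~ end_sets e1 (half_tree g x)) (e2x : end_sets e2 (half_tree g x)).

(** Two rays glued at [g]. As [Negz n] stands for [-(n+1)], it is sent to vertex [n.+1] of the
    backward ray. *)
Let l (j : int) : F :=
  match j with Posz n => ray e2 g n | Negz n => ray e1 g n.+1 end.

Let y (j : int) : letter k :=
  match j with
  | Posz n => dir e2 (ray e2 g n)
  | Negz n => letter_inv (dir e1 (ray e1 g n))
  end.

Let Posz1 n : Posz n + 1 = Posz n.+1. Proof. by rewrite -PoszD addn1. Qed.
Let Negz1 n : Negz n.+1 + 1 = Negz n. Proof. by rewrite !NegzE; lia. Qed.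

Let l_step j : l (j + 1) = (l j * lval (y j))%g.
Proof.
case: j => [n|[|n]]; first by rewrite Posz1.
- by rewrite /= letter_valV mulgK.
- by rewrite Negz1 /= letter_valV mulgK.
Qed.

Let y_step j : y (j + 1) != letter_inv (y j).
Proof.
case: j => [n|[|n]]; first by rewrite Posz1; exact: dir_ray.
(* Backtracking at the junction would make both ends leave [g] through [x], against [e1x]. *)
- rewrite /= letter_invK; apply/eqP => d; apply: e1x.
  by rewrite -(dir_uniq e2x) d; exact: dirP.
- rewrite Negz1 /y letter_invK; apply/eqP => d.
  by have := dir_ray freeA e1 g n; rewrite -d eqxx.
Qed.

Let l_word (m : int) n : l (m + n%:Z) = (l m * val (mkseq (fun i => y (m + i%:Z)) n))%g.
Proof.
elim: n => [|n IH]; first by rewrite word_val0 mulg1 addr0.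
by rewrite mkseqS word_val_rcons mulgA -IH -l_step; congr l; lia.
Qed.

Lemma line_between : exists l : int -> F,
  line_from_to A l e1 e2 /\ forall n : nat, l n%:Z = ray e2 g n.
Proof.
exists l; split=> //; split.
- split=> [j|m n w]; first by exists (y j).
  (* Any word joining two vertices of the line reduces to the label of the segment, and reduction
     never lengthens. *)
  rewrite l_word => /mulgI E; suff <- : size (reduce w) = n by exact: size_reduce.
  rewrite -(nf_val freeA) -E nf_reduced ?size_mkseq //.
  by apply: reduced_mkseq => i; have := y_step (m + i%:Z); congr (y _ != _); lia.
- have := @ray_converges _ _ _ freeA e1 g; congr (converges_to _ _).
  by apply/funext => -[|n].
- exact: ray_converges.
Qed.

End Construct.

End Lines.

Section Cylinder.
Context (k : nat) (F : freeGroup k) (A : 'I_k -> F) (freeA : free_basis A).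
Local Notation lval := (letter_val A).
Local Notation wval := (word_val A).
Local Notation half_tree := (half_tree freeA).
Implicit Types (g h v : F) (x y z : letter k) (w u : seq (letter k)).

Definition rectangle (P Q : set F) : set (dbdry F) :=
  [set p | end_sets (val p).1 P /\ end_sets (val p).2 Q].

Lemma open_end_sets (S : set F) : almost_invariant S ->
  open [set e : ends F | end_sets e S].
Proof.
move=> aS; exists [set S]; last by rewrite bigcup_set1.
by move=> _ ->.
Qed.

Lemma rectangle_open (P Q : set F) : almost_invariant P -> almost_invariant Q ->
  open (rectangle P Q).
Proof.
move=> aP aQ.
have cv : continuous (fun q : dbdry F => val q) := @initial_continuous _ _ set_val.
have c1 : continuous (fun q : dbdry F => (val q).1).
  by move=> p; apply: continuous_comp (cv p) cvg_fst.
have c2 : continuous (fun q : dbdry F => (val q).2).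
  by move=> p; apply: continuous_comp (cv p) cvg_snd.
have -> : rectangle P Q = (fun q : dbdry F => (val q).1) @^-1` [set e | end_sets e P] `&`
   (fun q : dbdry F => (val q).2) @^-1` [set e | end_sets e Q] by [].
by apply: openI; [have /continuousP := c1 | have /continuousP := c2]; apply; exact: open_end_sets.
Qed.

Lemma rectangle_measurable (P Q : set F) : almost_invariant P -> almost_invariant Q ->
  measurable (rectangle P Q : set (borel_dbdry F)).
Proof. by move=> aP aQ; apply: sub_sigma_algebra; exact: rectangle_open. Qed.

(** In a tree, a line traverses a reduced path as soon as it starts behind the first edge and ends
    beyond the last: half-trees along the path are nested. *)
Lemma Cyl_rectangle g w x w' u y : reduced w -> w = x :: w' -> w = rcons u y ->
  Cyl A g w = rectangle (~` half_tree g x) (half_tree (g * wval u)%g y).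
Proof.
move=> rw wx wy; apply/seteqP; split=> [p [l [[geo c1 c2] [m lm]]]|p [p1 p2]].
(* Convergence is tested at times beyond [N], enlarged by [absz j] so that they also lie past the
   crossing at [j]. *)
- have conv z v (j : int) : l j = v -> l (j + 1) = (v * lval z)%g ->
      end_sets (val p).1 (~` half_tree v z) /\ end_sets (val p).2 (half_tree v z).
    move=> l0 l1; have lj := geodesic_line_half_tree freeA geo l0 l1.
    have aH := half_tree_almost_invariant freeA v z.
    split; first (apply/end_setC => //); last apply: contrapT => /(end_setC _ aH).
      move=> /c1[N /(_ (N + absz j)%N (leq_addr _ _))].
      have := (lj (absz (j + (N + absz j)%N%:Z))).2.
      by have -> : j - (absz (j + (N + absz j)%N%:Z))%:Z = - (N + absz j)%N%:Z by lia.
    move=> /c2[N /(_ (N + (absz j + 1))%N (leq_addr _ _))].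
    have := (lj (absz ((N + (absz j + 1))%N%:Z - j - 1)%R)).1.
    by have -> : j + 1 + (absz ((N + (absz j + 1))%N%:Z - j - 1)%R)%:Z
                 = (N + (absz j + 1))%N%:Z by lia.
  split.
    apply: (conv x g m _ _).1; first by have := lm 0%N isT; rewrite addr0 take0 word_val0 mulg1.
    by have := lm 1%N; rewrite wx /= take0 word_val1; apply.
  apply: (conv y _ (m + (size u)%:Z) _ _).2.
    by rewrite lm wy ?size_rcons // -cats1 take_size_cat.
  have -> : m + (size u)%:Z + 1 = m + (size u).+1%:Z by lia.
  by rewrite lm wy ?size_rcons // -(size_rcons u y) take_size word_val_rcons mulgA.
(* The second end lies beyond every edge of the path, so by [dir_uniq] the ray from [g] spells
   [w]. *)
- have sub i : (i < size w)%N ->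
      end_sets (val p).2 (half_tree (g * wval (take i w))%g (nth x w i)).
    move=> iw; have iu : (i <= size u)%N by move: iw; rewrite wy size_rcons.
    apply: end_up p2; first exact: half_tree_almost_invariant.
    have -> : (g * wval u)%g = (g * wval (take i w) * wval (drop i u))%g.
      by rewrite -mulgA -word_val_cat wy -cats1 takel_cat // cat_take_drop.
    have -> : nth x w i = head y (drop i u).
      rewrite wy nth_rcons -nth0 nth_drop addn0; case: ltngtP iu => // [iu _|-> _].
        exact: set_nth_default.
      by rewrite nth_default.
    apply: half_tree_sub; suff /reduced_cat[] : reduced (take i u ++ rcons (drop i u) y) by [].
    by rewrite -rcons_cat cat_take_drop -wy.
  have e1x : ~ end_sets (val p).1 (half_tree g x).
    by apply/end_setC => //; exact: half_tree_almost_invariant.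
  have e2x : end_sets (val p).2 (half_tree g x).
    by have := sub 0%N; rewrite wx /= word_val0 mulg1; apply.
  have [l [ll lray]] := line_between e1x e2x.
  exists l; split=> //; exists 0 => i; rewrite add0r lray.
  elim: i => [|i IH] iw; first by rewrite take0 word_val0 mulg1.
  by rewrite /= IH ?(ltnW iw) // (dir_uniq (sub i iw)) (take_nth x) // word_val_rcons mulgA.
Qed.

End Cylinder.

(** * Integrals of products of edge jumps *)

Section HasIntegral.
Context d (T : measurableType d) (R : realType) (mu : {measure set T -> \bar R}).
Implicit Types (h f : T -> R) (v : R).

(** Integrability is bundled with a finite value, so that linear combinations are computed in
    [R]. *)
Definition has_integral h v :=
  mu.-integrable setT (EFin \o h) /\ (\int[mu]_x (h x)%:E = v%:E)%E.

Lemma has_integral_eq h f v : h =1 f -> has_integral h v -> has_integral f v.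
Proof. by move=> /funext ->. Qed.

Lemma has_integral_indic (E : set T) v : measurable E -> mu E = v%:E ->
  has_integral \1_E v.
Proof.
move=> mE Ev; split; last by rewrite integral_indic // setIT.
apply/integrableP; split; first exact/measurable_EFinP/measurable_indic.
rewrite (eq_integral (fun x => (\1_E x)%:E)); first by rewrite integral_indic // setIT Ev ltry.
by move=> x _ /=; rewrite ger0_norm // indicE.
Qed.

Lemma has_integral0 : has_integral (fun=> 0) 0.
Proof.
by split; [exact: integrable0 | rewrite integral0].
Qed.

Lemma has_integralD h f v w :
  has_integral h v -> has_integral f w -> has_integral (fun x => h x + f x) (v + w).
Proof.
move=> [ih eh] [jf ef]; split; first exact: (integrableD measurableT ih jf).
by rewrite EFinD -eh -ef -integralD_EFin.
Qed.

Lemma has_integralZ (c : R) h v :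
  has_integral h v -> has_integral (fun x => c * h x) (c * v).
Proof.
move=> [ih eh]; split; first exact: (integrableZl measurableT c ih).
by rewrite EFinM -eh -integralZl.
Qed.

Lemma has_integral_sum (I : Type) (s : seq I) (h : I -> T -> R) (v : I -> R) :
  (forall i, has_integral (h i) (v i)) ->
  has_integral (fun x => \sum_(i <- s) h i x) (\sum_(i <- s) v i).
Proof.
move=> hv; elim: s => [|i s IH].
  rewrite big_nil; apply: has_integral_eq has_integral0 => x.
  by rewrite big_nil.
rewrite big_cons; apply: has_integral_eq (has_integralD (hv i) IH) => x.
by rewrite big_cons.
Qed.

(** Nonnegativity gives additivity even at infinite measure; finiteness of the intersection form is
    then a conclusion. *)
Lemma integral_indicD (E1 E2 : set T) : measurable E1 -> measurable E2 ->
  (\int[mu]_x (\1_E1 x + \1_E2 x : R)%:E = mu E1 + mu E2)%E.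
Proof.
move=> m1 m2; under eq_integral => x _ do rewrite EFinD.
rewrite ge0_integralD //=.
- by rewrite !integral_indic // !setIT.
- exact/measurable_EFinP/measurable_indic.
- exact/measurable_EFinP/measurable_indic.
Qed.

End HasIntegral.

(** * Jumps of a line across edges, and their products *)

Section Jump.
Context (R : realType) (k : nat) (F : freeGroup k) (A : 'I_k -> F) (freeA : free_basis A).
Local Notation lval := (letter_val A).
Local Notation wval := (word_val A).
Local Notation half_tree := (half_tree freeA).
Implicit Types (p : dbdry F) (g h v : F) (x y z : letter k) (w u : seq (letter k)).

(* The algebraic number of times the line from p.1 to p.2 enters S. *)
Definition jump S p : R := end_ind R (val p).2 S - end_ind R (val p).1 S.

Lemma jumpC S p : almost_invariant S -> jump (~` S) p = - jump S p.
Proof. by move=> aS; rewrite /jump !end_indC //; lra. Qed.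

Lemma rectangle_indic (P Q : set F) p :
  \1_(rectangle P Q) p = end_ind R (val p).1 P * end_ind R (val p).2 Q.
Proof.
rewrite indicE /end_ind; case: asboolP => [h1|h1]; last first.
  by rewrite mul0r memNset // => -[].
case: asboolP => [h2|h2]; first by rewrite mul1r mem_set.
by rewrite mulr0 memNset // => -[].
Qed.

(** An end in [Q] is in [P], so the product of the two indicators at one end is that of [Q].
    Expanding leaves the lines from outside [P] into [Q] and their reverses. *)
Lemma jump_mul_sub (P Q : set F) p : almost_invariant P -> almost_invariant Q -> Q `<=` P ->
  jump P p * jump Q p = \1_(rectangle (~` P) Q) p + \1_(rectangle Q (~` P)) p.
Proof.
move=> aP aQ QP; rewrite !rectangle_indic !end_indC // /jump.
have up (e : ends F) : end_ind R e Q * end_ind R e P = end_ind R e Q.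
  rewrite /end_ind; case: (asboolP (end_sets e Q)) => [eQ|]; last by rewrite mul0r.
  by rewrite asboolT ?mulr1 //; exact: end_up eQ.
have u1 := up (val p).1; have u2 := up (val p).2.
transitivity (end_ind R (val p).2 Q * end_ind R (val p).2 P
    + end_ind R (val p).1 Q * end_ind R (val p).1 P
    - end_ind R (val p).2 P * end_ind R (val p).1 Q
    - end_ind R (val p).1 P * end_ind R (val p).2 Q); first by ring.
by rewrite u1 u2; ring.
Qed.

Lemma jump_sqr S p : almost_invariant S ->
  jump S p ^+ 2 = \1_(rectangle (~` S) S) p + \1_(rectangle S (~` S)) p.
Proof. by move=> aS; rewrite expr2 jump_mul_sub. Qed.

Let ht g x := half_tree_almost_invariant freeA g x.

Lemma jump_inv g x p :
  jump (half_tree (g * lval x)%g (letter_inv x)) p = - jump (half_tree g x) p.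
Proof. by rewrite half_treeC jumpC. Qed.

(** Both edges point along [w], so nonzero jumps have equal signs; the second cylinder is that of
    the path read backwards. *)
Lemma jump_path g w x w' u y p : reduced w -> w = x :: w' -> w = rcons u y ->
  jump (half_tree g x) p * jump (half_tree (g * wval u)%g y) p =
  \1_(Cyl A g w) p + \1_(Cyl A (g * wval w)%g (word_inv w)) p.
Proof.
move=> rw wx wy; rewrite jump_mul_sub //; last first.
  have -> : x = head y u by case: u wy => [|x' u]; rewrite wx /= => -[].
  by apply: half_tree_sub; rewrite -wy.
rewrite (Cyl_rectangle freeA g rw wx wy).
rewrite (@Cyl_rectangle _ _ _ freeA _ (word_inv w) (letter_inv y) (word_inv u)
   (word_inv w') (letter_inv x)) ?reduced_inv //.
- congr (_ + \1_(rectangle _ _) p).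
    by rewrite wy word_val_rcons mulgA half_treeC setCK.
  rewrite word_val_inv -half_treeC; congr (half_tree _ _).
  by rewrite -mulgA wx word_val_cons mulgK.
- by rewrite wy /word_inv map_rcons rev_rcons.
- by rewrite wx /word_inv /= rev_cons.
Qed.

Section Uniform.
Variable (nu : current R F).
Hypothesis unu : uniform_current A nu.

Definition uniform_mass (n : nat) : R := (2 * k%:R * (2 * k%:R - 1) ^+ n.-1)^-1.

Lemma has_integral_path g w x w' u y : reduced w -> w = x :: w' -> w = rcons u y ->
  has_integral nu (fun p => jump (half_tree g x) p * jump (half_tree (g * wval u)%g y) p)
    (2 * uniform_mass (size w)).
Proof.
move=> rw wx wy; have w1 : (1 <= size w)%N by rewrite wx.
have mC g' w'' x' u'' u' y' : reduced w'' -> w'' = x' :: u'' -> w'' = rcons u' y' ->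
    measurable (Cyl A g' w'' : set (borel_dbdry F)).
  move=> rw' wx' wy'; rewrite (Cyl_rectangle freeA g' rw' wx' wy').
  by apply: rectangle_measurable => //; exact: almost_invariantC.
have sw : size (word_inv w) = size w by rewrite size_rev size_map.
have wy' : word_inv w = letter_inv y :: word_inv u by rewrite wy /word_inv map_rcons rev_rcons.
have wx' : word_inv w = rcons (word_inv w') (letter_inv x) by rewrite wx /word_inv /= rev_cons.
have i1 := has_integral_indic (mC g _ _ _ _ _ rw wx wy) (unu g rw w1).
have w1' : (1 <= size (word_inv w))%N by rewrite sw.
have i2 := has_integral_indic (mC (g * wval w)%g _ _ _ _ _ (reduced_inv rw) wy' wx')
  (unu (g * wval w)%g (reduced_inv rw) w1').
have := has_integralD i1 i2; rewrite sw -mulr2n -[_ *+ 2]mulr_natl.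
by apply: has_integral_eq => p; rewrite -(jump_path g p rw wx wy).
Qed.

(* The geodesic spanned by the edge labelled x at 1 and the edge labelled z at
   the vertex u, with the sign comparing their orientations along it. *)
Definition edge_span u x z : bool * seq (letter k) :=
  let: (s, w) := if ohead u == Some x then (false, u) else (true, letter_inv x :: u) in
  if ohead (rev w) == Some (letter_inv z) then (~~ s, w) else (s, rcons w z).

(** Reversing an edge negates its jump. Both edges are turned to point along the geodesic they span,
    where [has_integral_path] applies. *)
Lemma has_integral_jump_mul g h x z :
  let: (s, w) := edge_span (nf freeA (g^-1 * h)%g) x z in
  has_integral nu (fun p => jump (half_tree g x) p * jump (half_tree h z) p)
    ((-1) ^+ s * (2 * uniform_mass (size w))).
Proof.
set u := nf _ _; have ru : reduced u by exact: reduced_nf.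
have gu : (g * wval u)%g = h by rewrite nfK mulVKg.
rewrite /edge_span.
(* First the edge at [g]: either it already begins the path [u] to [h], or its reverse is put in
   front. *)
have [s [w [-> [g' [y [w' [wy rw gw jy]]]]]]] : exists s w,
    (if ohead u == Some x then (false, u) else (true, letter_inv x :: u)) = (s, w) /\
    exists g' y w', [/\ w = y :: w', reduced w, (g' * wval w)%g = h &
      forall p, jump (half_tree g x) p = (-1) ^+ s * jump (half_tree g' y) p].
  case: eqP => [ux|/eqP ux].
    exists false, u; split=> //; exists g, x, (behead u); split=> //.
      by case: (u) ux => //= ? ? [->].
    by move=> p; rewrite expr0 mul1r.
  exists true, (letter_inv x :: u); split=> //.
  exists (g * lval x)%g, (letter_inv x), u; split=> //.
  - by rewrite reduced_cons letter_invK ux.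
  - by rewrite word_val_cons letter_valV -mulgA mulVKg.
  - by move=> p; rewrite jump_inv expr1 mulN1r opprK.
(* Then the edge at [h]: a path ending in [letter_inv z] already contains it backwards; otherwise it
   extends the path. *)
case: eqP => [wz|/eqP wz].
  have [u' wu] : exists u', w = rcons u' (letter_inv z).
    exists (rev (behead (rev w))); rewrite -rev_cons -[LHS]revK; congr rev.
    by case: (rev w) wz => //= ? ? [->].
  have := has_integralZ ((-1) ^+ ~~ s) (has_integral_path g' rw wy wu).
  apply: has_integral_eq => p; rewrite jy.
  have -> : half_tree h z = half_tree (g' * wval u' * lval (letter_inv z))%g (letter_inv (letter_inv z)).
    by rewrite -mulgA -word_val_rcons -wu gw letter_invK.
  by rewrite jump_inv; case: (s); rewrite /= ?expr0 ?expr1; ring.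
have rwz : reduced (rcons w z) by rewrite reduced_rcons rw.
have := has_integralZ ((-1) ^+ s) (@has_integral_path g' (rcons w z) y (rcons w' z) w z rwz _ erefl).
rewrite gw wy => /(_ erefl); apply: has_integral_eq => p; rewrite jy.
by ring.
Qed.

End Uniform.
End Jump.

(** * The intersection form of an image of the uniform current *)

Section Substitution.
Context (k : nat).
Implicit Types (x y : letter k) (u w : seq (letter k)) (W : 'I_k -> seq (letter k)).

Definition subst W w :=
  flatten [seq if x.2 then W x.1 else word_inv (W x.1) | x <- w].

(* Occurrences of x and of its inverse in w, each with its sign and with the
   prefix of w, preceded by u, that leads to the origin of the x-edge. *)
Fixpoint occurrences x u w : seq (bool * seq (letter k)) :=
  if w is y :: w' then
    (if y == x then [:: (false, u)]
     else if y == letter_inv x then [:: (true, rcons u y)] else [::])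
    ++ occurrences x (rcons u y) w'
  else [::].

(* For an automorphism given by W with inverse given by V, the edges whose
   images traverse the edge labelled x at 1, signed by the direction. *)
Definition crossings W V x : seq ('I_k * (bool * seq (letter k))) :=
  [seq (z, (o.1, word_inv (subst V o.2))) | z <- enum 'I_k, o <- occurrences x [::] (W z)].

End Substitution.

(** * Pulling a half-tree back along an automorphism *)

Section Pullback.
Context (R : numDomainType) (F : groupType) (k : nat) (A : 'I_k -> F) (freeA : free_basis A).
Local Notation lval := (letter_val A).
Local Notation wval := (word_val A).
Local Notation half_tree := (half_tree freeA).
Implicit Types (g h v : F) (x y z : letter k) (w u : seq (letter k)).

(** [half_tree_step] is telescoped along [w]; a term survives when the origin of an occurrence is
    translated to 1. *)
Lemma half_tree_path x g u w :
  ((g * wval u * wval w)%g \in half_tree 1%g x)%:R - ((g * wval u)%g \in half_tree 1%g x)%:R =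
  \sum_(o <- occurrences x u w) (-1) ^+ o.1 * (g * wval o.2 == 1)%g%:R :> R.
Proof.
elim: w u => [|y w IH] u; first by rewrite word_val0 mulg1 subrr big_nil.
rewrite /= big_cat /= -IH word_val_rcons word_val_cons !mulgA.
set f := (g * wval u)%g; have E := half_tree_step freeA R 1%g x f y.
rewrite -[LHS](subrKA (((f * lval y)%g \in half_tree 1%g x)%:R)) addrC E mul1g.
congr (_ + _); have [yx|yx] := eqVneq y x.
  rewrite yx [x == letter_inv x]eq_sym (negbTE (letter_inv_neq x)).
  by rewrite andbT andbF subr0 big_seq1 mul1r.
have [yx'|yx'] := eqVneq y (letter_inv x); last by rewrite !andbF subr0 big_nil.
(* An edge traversed backwards has its origin at the end of the step, hence the prefix
   [rcons u y]. *)
rewrite andbF andbT big_seq1 sub0r /= expr1 mulN1r word_val_rcons mulgA -/f.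
by rewrite yx' letter_valV -(inj_eq (mulIg (lval x)) (f * _)%g) mulgVK mul1g.
Qed.

Lemma morph_subst (f : {multiplicative F -> F}) (V : 'I_k -> seq (letter k)) u :
  (forall i, f (wval (V i)) = A i) -> f (wval (subst V u)) = wval u.
Proof.
move=> fV; have f1 : f 1%g = 1%g by apply: (mulgI (f 1%g)); rewrite -gmulfM !mulg1.
elim: u => [|[i b] u IH]; first by rewrite /subst /= word_val0.
rewrite /subst /= word_val_cat gmulfM -/(subst V u) IH word_val_cons; congr (_ * _)%g.
case: b => /=; first by rewrite fV.
rewrite word_val_inv /letter_val /=; apply: (mulgI (f (wval (V i)))).
by rewrite -gmulfM mulgV f1 fV mulgV.
Qed.

Variables (phi : automorphism F) (W V : 'I_k -> seq (letter k)).
Hypotheses (phiW : forall i, phi (A i) = wval (W i))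
           (phiV : forall i, phi (wval (V i)) = A i).

(** The constant [c0] is harmless, since it cancels in the difference of two ends. *)
Lemma half_tree_pullback x : exists c0 : R, forall g,
  (phi g \in half_tree 1%g x)%:R -
  \sum_(a <- crossings W V x)
     (-1) ^+ a.2.1 * (g \in half_tree (wval a.2.2) (a.1, true))%:R = c0.
Proof.
pose d g : R := (phi g \in half_tree 1%g x)%:R - \sum_(a <- crossings W V x)
  (-1) ^+ a.2.1 * (g \in half_tree (wval a.2.2) (a.1, true))%:R.
exists (d 1%g) => g; rewrite -/(d g).
have phi_inj : injective phi by have [f fK _] := aut_bij phi; exact: can_inj fK.
have phi1 : phi 1%g = 1%g by apply: (mulgI (phi 1%g)); rewrite -gmulfM !mulg1.
have step h (z : 'I_k) : d (h * A z)%g = d h.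
  apply/eqP; rewrite -subr_eq0 /d opprB [_ - (phi h \in _)%:R]addrC addrACA.
  rewrite [- \sum_(_ <- _) _ + _]addrC -opprB -sumrB.
  rewrite gmulfM phiW; have := half_tree_path x (phi h) [::] (W z).
  rewrite word_val0 mulg1 opprB => ->; rewrite -[X in _ + X]opprK -sumrN subr_eq0; apply/eqP.
  rewrite [RHS](_ : _ = \sum_(a <- crossings W V x)
      (-1) ^+ a.2.1 * ((h == wval a.2.2) && (z == a.1))%:R); last first.
    apply: eq_bigr => a _; rewrite opprB -mulrBr; congr (_ * _).
    have := half_tree_step freeA R (wval a.2.2) (a.1, true) h (z, true).
    rewrite {1}/letter_val /= => ->.
    by rewrite !xpair_eqE andbT /= !andbF subr0.
  rewrite big_allpairs_dep big_enum /= (bigD1 z) //= [X in _ = _ + X]big1 ?addr0.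
    apply: eq_bigr => o _; rewrite eqxx andbT; congr (_ * (_ : bool)%:R).
    (* An occurrence counts when [phi h] times its prefix is 1; the inverse substitution [V] turns
       this into an equation for [h]. *)
    rewrite word_val_inv -[RHS](inj_eq phi_inj) -(inj_eq (mulIg (wval o.2)) (phi h)).
    by rewrite /= -[X in (_ == _ * X)%g](morph_subst _ phiV) -gmulfM mulVg phi1.
  by move=> i iz; apply: big1 => o _; rewrite [z == _]eq_sym /= (negbTE iz) andbF mulr0.
have lstep h y : d (h * lval y)%g = d h.
  case: y => i []; rewrite /letter_val /=; first exact: step.
  by rewrite -(step (h * _)%g i) mulgVK.
rewrite -(nfK freeA g); elim/last_ind: (nf freeA g) => [|w y IH]; first by rewrite word_val0.
by rewrite word_val_rcons lstep.
Qed.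

End Pullback.

(** * Automorphisms defined by substitutions *)

Section Automorphisms.
Context (F : groupType) (k : nat) (A : 'I_k -> F) (freeA : free_basis A).
Local Notation wval := (word_val A).
Implicit Types (W V : 'I_k -> seq (letter k)).

Lemma subst_morphism W : exists f : {multiplicative F -> F},
  forall w, f (wval w) = wval (subst W w).
Proof.
pose f g := wval (subst W (nf freeA g)).
have fE w : f (wval w) = wval (subst W w).
  by rewrite /f nf_val !word_val_subst word_val_reduce.
have fM : {morph f : x y / (x * y)%g}.
  move=> x y; rewrite -{1}(nfK freeA x) -{1}(nfK freeA y) -word_val_cat fE.
  by rewrite /subst map_cat flatten_cat word_val_cat.
pose mix := isMultiplicative.Build F F f fM.
by exists (HB.pack f mix : {multiplicative F -> F}).
Qed.

Lemma subst_automorphism W V :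
  (forall i, reduce (subst W (V i)) = [:: (i, true)]) ->
  (forall i, reduce (subst V (W i)) = [:: (i, true)]) ->
  exists phi psi : automorphism F, [/\ cancel phi psi, cancel psi phi,
    forall i, phi (A i) = wval (W i) & forall i, psi (A i) = wval (V i)].
Proof.
move=> WV VW; have [f fW] := subst_morphism W; have [h hV] := subst_morphism V.
have AE i : A i = wval [:: (i, true)] by rewrite word_val1.
have s1 U i : wval (subst U [:: (i, true)]) = wval (U i) by rewrite /subst /= cats0.
have hK : cancel h f.
  move=> g; rewrite -(nfK freeA g) hV; apply: morph_subst => i.
  by rewrite fW -word_val_reduce WV -AE.
have fK : cancel f h.
  move=> g; rewrite -(nfK freeA g) fW; apply: morph_subst => i.
  by rewrite hV -word_val_reduce VW -AE.
exists (@Automorphism _ f (Bijective fK hK)), (@Automorphism _ h (Bijective hK fK)).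
by split=> //= i; rewrite AE ?fW ?hV s1.
Qed.

End Automorphisms.

(** * The intersection form as a sum over pairs of crossings *)

Section Stretch.
Context (R : realType) (k : nat) (F : freeGroup k) (A : 'I_k -> F) (freeA : free_basis A).
Local Notation lval := (letter_val A).
Local Notation wval := (word_val A).
Local Notation half_tree := (half_tree freeA).
Variables (phi : automorphism F) (W V : 'I_k -> seq (letter k)).
Hypotheses (phiW : forall i, phi (A i) = wval (W i))
           (phiV : forall i, phi (wval (V i)) = A i).

Let ht g x := half_tree_almost_invariant freeA g x.

Lemma jump_aut x (p : dbdry F) :
  jump R (half_tree 1%g x) (aut_dbdry phi p) =
  \sum_(a <- crossings W V x)
     (-1) ^+ a.2.1 * jump R (half_tree (wval a.2.2) (a.1, true)) p.
Proof.
have [c0 rel] := half_tree_pullback R freeA phiW phiV x.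
have E (e : ends F) : end_ind R e (phi @^-1` half_tree 1%g x) -
    \sum_(a <- crossings W V x) (-1) ^+ a.2.1 * end_ind R e (half_tree (wval a.2.2) (a.1, true)) = c0.
  (* [None] indexes the pulled-back half-tree and [Some] the crossings, which gives a single
     relation for [end_ind_relation]. *)
  pose S (o : option ('I_k * (bool * seq (letter k)))) := if o is Some a then half_tree (wval a.2.2) (a.1, true)
              else phi @^-1` half_tree 1%g x.
  pose c (o : option ('I_k * (bool * seq (letter k)))) : R := if o is Some a then - (-1) ^+ a.2.1 else 1.
  have aS o : almost_invariant (S o).
    by case: o => [a|]; [exact: ht | have [? [_ _ + _]] := ai_iso_aut phi; apply; exact: ht].
  have := @end_ind_relation _ R e _ (None :: map Some (crossings W V x)) c S c0 aS.
  rewrite big_cons big_map /= mul1r => <- => [|g].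
    by congr (_ + _); rewrite -sumrN; apply: eq_bigr => a _; rewrite mulNr.
  rewrite -(rel g) big_cons big_map mul1r; congr (_ + _).
  by rewrite -sumrN; apply: eq_bigr => a _; rewrite mulNr.
rewrite /jump.
have -> : \sum_(a <- crossings W V x) (-1) ^+ a.2.1 *
    (end_ind R (val p).2 (half_tree (wval a.2.2) (a.1, true)) -
     end_ind R (val p).1 (half_tree (wval a.2.2) (a.1, true))) =
  \sum_(a <- crossings W V x) (-1) ^+ a.2.1 * end_ind R (val p).2 (half_tree (wval a.2.2) (a.1, true)) -
  \sum_(a <- crossings W V x) (-1) ^+ a.2.1 * end_ind R (val p).1 (half_tree (wval a.2.2) (a.1, true)).
  by rewrite -sumrB; apply: eq_bigr => a _; rewrite mulrBr.
rewrite -[end_ind R (val (aut_dbdry phi p)).2 _]/(end_ind R (val p).2 (phi @^-1` half_tree 1%g x)).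
rewrite -[end_ind R (val (aut_dbdry phi p)).1 _]/(end_ind R (val p).1 (phi @^-1` half_tree 1%g x)).
have /eqP := E (val p).1; have /eqP := E (val p).2; rewrite !subr_eq => /eqP -> /eqP ->.
by rewrite opprD addrACA subrr add0r.
Qed.

Variable (nu : current R F).
Hypothesis unu : uniform_current A nu.

(** The relative position of the two edges is reduced as a word, without reference to the group, so
    that sign and length can be evaluated. *)
Definition crossing_pair (a b : 'I_k * (bool * seq (letter k))) : bool * nat :=
  let: (s, w) := edge_span (reduce (word_inv a.2.2 ++ b.2.2)) (a.1, true) (b.1, true) in
  (a.2.1 (+) b.2.1 (+) s, size w).

Definition crossing_mass (t : bool * nat) : R := (-1) ^+ t.1 * (2 * uniform_mass R k t.2).

Definition crossing_sum W' V' x : R :=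
  \sum_(c <- @crossings k W' V' x) \sum_(d <- @crossings k W' V' x)
    crossing_mass (crossing_pair c d).

Lemma has_integral_jump_sqr x :
  has_integral nu (fun p => jump R (half_tree 1%g x) (aut_dbdry phi p) ^+ 2)
    (crossing_sum W V x).
Proof.
have := @has_integral_sum _ _ _ nu _ (crossings W V x) (fun a p => \sum_(b <- crossings W V x)
   (-1) ^+ (a.2.1 (+) b.2.1) * (jump R (half_tree (wval a.2.2) (a.1, true)) p *
                               jump R (half_tree (wval b.2.2) (b.1, true)) p))
  (fun a => \sum_(b <- crossings W V x) crossing_mass (crossing_pair a b)).
move=> H; apply: has_integral_eq (H _) => [p|a].
  rewrite jump_aut expr2 mulr_suml; apply: eq_bigr => a _.
  rewrite mulr_sumr; apply: eq_bigr => b _; rewrite signr_addb; ring.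
apply: has_integral_sum => b.
have := has_integral_jump_mul freeA unu (wval a.2.2) (wval b.2.2) (a.1, true) (b.1, true).
rewrite -word_val_inv -word_val_cat nf_val /crossing_mass /crossing_pair.
case: edge_span => s w /(has_integralZ ((-1) ^+ (a.2.1 (+) b.2.1))).
by rewrite mulrA -signr_addb.
Qed.

(** A letter and its inverse are treated together: after a translation their cylinders are the two
    ways of crossing one edge, and the indicators add up to the squared jump. *)
Lemma intersection_form_aut : intersection_form A (aut_current phi nu) =
  (\sum_(i < k) crossing_sum W V (i, true))%:E.
Proof.
rewrite /intersection_form.
transitivity (\sum_(i < k) \sum_(b : bool) aut_current phi nu (Cyl A 1%g [:: (i, b)]))%E.
  by rewrite pair_bigA; apply: eq_bigr => -[].
rewrite -sumEFin; apply: eq_bigr => i _; rewrite big_bool /=.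
set H := half_tree 1%g (i, true); have aH : almost_invariant H by exact: ht.
have aC := almost_invariantC aH.
have C1 : Cyl A 1%g [:: (i, true)] = rectangle (~` H) H.
  by rewrite (@Cyl_rectangle _ _ _ freeA 1%g [:: (i, true)] (i, true) [::] [::] (i, true)) //
     word_val0 mulg1.
(* The translation moves the edge labelled [(i, false)] at 1 onto the reverse of the edge labelled
   [(i, true)] at 1. *)
have C2 : left_dbdry (lval (i, false)) @^-1` Cyl A 1%g [:: (i, false)] = rectangle H (~` H).
  rewrite (@Cyl_rectangle _ _ _ freeA 1%g [:: (i, false)] (i, false) [::] [::] (i, false)) //.
  have HC : (fun f : F => (lval (i, false) * f)%g) @^-1` half_tree 1%g (i, false) = ~` H.
    rewrite -[X in half_tree X](mulVg (lval (i, true))) (half_tree_mull freeA).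
    by rewrite -[(i, false)]/(letter_inv (i, true)) -half_treeC mul1g.
  by rewrite word_val0 mulg1 -{1}[H]setCK -HC.
have mR1 : measurable (rectangle (~` H) H : set (borel_dbdry F)) by exact: rectangle_measurable.
have mR2 : measurable (rectangle H (~` H) : set (borel_dbdry F)) by exact: rectangle_measurable.
have mC : measurable (Cyl A 1%g [:: (i, false)] : set (borel_dbdry F)).
  rewrite (@Cyl_rectangle _ _ _ freeA 1%g [:: (i, false)] (i, false) [::] [::] (i, false)) //.
  by apply: rectangle_measurable; first apply: almost_invariantC; exact: ht.
rewrite -(current_invariant (aut_current phi nu) (lval (i, false)) mC) C1 C2.
have [ih <-] := has_integral_jump_sqr (i, true).
rewrite -/H.
have pb := dbdry_map_borel (ai_iso_aut phi).
rewrite -[LHS]/(nu (aut_dbdry phi @^-1` rectangle (~` H) H) +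
                nu (aut_dbdry phi @^-1` rectangle H (~` H)))%E.
rewrite -(integral_indicD nu (pb _ mR1) (pb _ mR2)).
by apply: eq_integral => p _; rewrite jump_sqr.
Qed.

End Stretch.

(** * The example *)

Section Example.
Context (R : realType) (n : nat).
Local Notation k := n.+2.
Local Notation i0 := (ord0 : 'I_k).
Local Notation i1 := (lift ord0 ord0 : 'I_k).
Local Notation a := (i0, true).
Local Notation b := (i1, true).
Local Notation a' := (i0, false).
Local Notation b' := (i1, false).

Definition word2 (u v : seq (letter k)) (i : 'I_k) : seq (letter k) :=
  if i == i0 then u else if i == i1 then v else [:: (i, true)].

Definition phi_word := word2 [:: a; b; a; b; a] [:: b; a].
Definition psi_word := word2 [:: a; b'; b'] [:: b; b; b; a'].

Lemma phi_psi i : reduce (subst phi_word (psi_word i)) = [:: (i, true)].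
Proof.
rewrite /psi_word /word2; case: eqP => [->|/eqP h0]; first by vm_compute.
case: eqP => [->|/eqP h1]; first by vm_compute.
by rewrite /subst /= cats0 /phi_word /word2 (negbTE h0) (negbTE h1).
Qed.

Lemma psi_phi i : reduce (subst psi_word (phi_word i)) = [:: (i, true)].
Proof.
rewrite /phi_word /word2; case: eqP => [->|/eqP h0]; first by vm_compute.
case: eqP => [->|/eqP h1]; first by vm_compute.
by rewrite /subst /= cats0 /psi_word /word2 (negbTE h0) (negbTE h1).
Qed.

(** Fixed generators do not cross edges labelled by the first two. Dropping them leaves a list that
    can be evaluated although [n] is a variable. *)
Lemma crossings_word2 u v V (i : 'I_k) : (i == i0) || (i == i1) ->
  crossings (word2 u v) V (i, true) =
  [seq (z, (o.1, word_inv (subst V o.2))) | z <- [:: i0; i1],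
     o <- occurrences (i, true) [::] (if z == i0 then u else v)].
Proof.
move=> i01; rewrite /crossings enum_ordSl enum_ordSl /=.
congr (_ ++ (_ ++ _)).
rewrite -map_comp; elim: (enum _) => //= j s ->; rewrite cats0.
rewrite /word2 /= xpair_eqE andbT.
by case/orP: i01 => /eqP ->.
Qed.

(** A generator beyond the first two is crossed only by its own edge at 1, so its term is the same
    for both automorphisms. *)
Lemma crossing_sum_fixed u v V (j : 'I_n) :
  all (fun y : letter k => (y.1 == i0) || (y.1 == i1)) (u ++ v) ->
  crossing_sum R (word2 u v) V (lift i0 (lift ord0 j), true) = 2 * uniform_mass R k 1.
Proof.
pose i : 'I_k := lift i0 (lift ord0 j); rewrite -/i all_cat => /andP[hu hv].
have i0i : (i0 == i) = false by vm_compute.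
have i1i : (i1 == i) = false by vm_compute.
have occ0 w p : all (fun y : letter k => (y.1 == i0) || (y.1 == i1)) w ->
    occurrences (i, true) p w = [::].
  elim: w p => //= -[z c] w IH p /andP[z01 /IH ->]; rewrite cats0.
  by rewrite /letter_inv /= !xpair_eqE; case/orP: z01 => /= /eqP ->; rewrite ?i0i ?i1i.
have occW z : occurrences (i, true) [::] (word2 u v z) =
    if z == i then [:: (false, [::])] else [::].
  rewrite /word2; case: eqP => [->|_]; first by rewrite occ0.
  case: eqP => [->|_]; first by rewrite occ0.
  by rewrite /= /letter_inv !xpair_eqE /= andbT andbF cats0.
have E : crossings (word2 u v) V (i, true) = [:: (i, (false, [::]))].
  have : if i \in enum 'I_k then true else false by rewrite mem_enum.
  rewrite /crossings; under eq_map => z do rewrite occW.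
  suff -> : flatten [seq [seq (z, (o.1, word_inv (subst V o.2))) | o <-
       if z == i then [:: (false, [::])] else [::]] | z <- enum 'I_k] =
       if i \in enum 'I_k then [:: (i, (false, [::]))] else [::] by case: ifP.
  elim: (enum _) (enum_uniq 'I_k) => //= z s IH /andP[zs us].
  rewrite IH // inE eq_sym; case: (i =P z) zs => [<- /negbTE ->|] //.
by rewrite /crossing_sum E !big_seq1 /crossing_pair /edge_span /= eqxx /crossing_mass mul1r.
Qed.

Lemma crossing_sum_pairs (W V : 'I_k -> seq (letter k)) x : crossing_sum R W V x =
  \sum_(t <- [seq crossing_pair c d | c <- crossings W V x, d <- crossings W V x])
    crossing_mass R k t.
Proof. by rewrite big_allpairs_dep. Qed.

Local Notation m := (uniform_mass R k).

Lemma phi_sum : crossing_sum R phi_word psi_word a + crossing_sum R phi_word psi_word b =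
  2 * (7 * m 1 - 4 * m 2 - 10 * m 3 - 4 * m 4).
Proof.
rewrite !crossing_sum_pairs !crossings_word2 //.
set la := [seq crossing_pair _ _ | _ <- _, _ <- _].
set lb := [seq crossing_pair _ _ | _ <- _, _ <- _].
(* Only signs and lengths are evaluated; the masses stay symbolic for [ring]. *)
vm_compute in la; vm_compute in lb; rewrite {}/la {}/lb.
rewrite !big_cons !big_nil /crossing_mass /=; ring.
Qed.

Lemma psi_sum : crossing_sum R psi_word phi_word a + crossing_sum R psi_word phi_word b =
  2 * (7 * m 1 - 10 * m 2 + 6 * m 3 - 4 * m 4 + 2 * m 5).
Proof.
rewrite !crossing_sum_pairs !crossings_word2 //.
set la := [seq crossing_pair _ _ | _ <- _, _ <- _].
set lb := [seq crossing_pair _ _ | _ <- _, _ <- _].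
vm_compute in la; vm_compute in lb; rewrite {}/la {}/lb.
rewrite !big_cons !big_nil /crossing_mass /=; ring.
Qed.

Lemma phi_psi_sum_neq :
  crossing_sum R phi_word psi_word a + crossing_sum R phi_word psi_word b !=
  crossing_sum R psi_word phi_word a + crossing_sum R psi_word phi_word b.
Proof.
rewrite phi_sum psi_sum /uniform_mass /= expr0 mulr1 expr1.
set t : R := 2 * n.+2%:R - 1.
have t3 : 3 <= t by rewrite /t -[n.+2]addn2 natrD; have := ler0n R n; lra.
have -> : 2 * n.+2%:R = t + 1 by rewrite /t; ring.
have t0 : t != 0 by lra.
have t1 : t + 1 != 0 by lra.
rewrite -subr_eq0; apply/eqP => E.
have : 6 * t ^+ 3 - 16 * t ^+ 2 - 2 = 0.
  (* The difference of the two sums is the polynomial times [2 / ((t + 1) * t ^+ 4)], which this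
     factor clears. *)
  transitivity ((t + 1) * t ^+ 4 / 2 * 0); last by rewrite mulr0.
  by rewrite -E; field; rewrite t0 t1.
nra.
Qed.

End Example.

Theorem theorem9p2 (R : realType) (k : nat) (F : freeGroup k) :
  ~ exists Ihat : current R F -> current R F -> R,
      [/\ (forall mu nu : current R F, Ihat mu nu = Ihat nu mu),
          (forall (phi : automorphism F) (mu nu : current R F),
             Ihat (aut_current phi mu) (aut_current phi nu) = Ihat mu nu) &
          (exists (A : 'I_k -> F) (r : R) (nA : current R F),
             [/\ free_basis A, 0 < r, uniform_current A nA &
                 forall nu : current R F,
                   (Ihat nA nu)%:E = (r%:E * intersection_form A nu)%E])].
Proof.
case: k F => [|[|n]] F; try by have := fg_rank_ge2 F.
move=> [Ihat [symI equivI [A [r [nA [freeA r0 unA IhatE]]]]]].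
have [phi [psi [phiK psiK phiA psiA]]] := subst_automorphism freeA (@phi_psi n) (@psi_phi n).
have psi_phi_nA : aut_current psi (aut_current phi nA) = nA.
  apply: current_ext => S mS; rewrite /= /pushforward; congr (nA _).
  apply/funext => p /=; congr S; apply: val_inj => /=.
  rewrite [RHS]surjective_pairing.
  by congr pair; apply: ends_ext; apply/funext => T /=; congr (end_sets _ _);
    apply/funext => g /=; rewrite phiK.
have IE : Ihat nA (aut_current phi nA) = Ihat nA (aut_current psi nA).
  (* Apply [psi] to both arguments, then exchange them. *)
  by rewrite -(equivI psi) psi_phi_nA symI.
have := IhatE (aut_current phi nA); rewrite IE IhatE.
rewrite (@intersection_form_aut _ _ _ _ freeA phi (@phi_word n) (@psi_word n) phiA _ _ unA); last first.
  by move=> i; rewrite -psiA psiK.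
rewrite (@intersection_form_aut _ _ _ _ freeA psi (@psi_word n) (@phi_word n) psiA _ _ unA); last first.
  by move=> i; rewrite -phiA phiK.
move=> /eqP; rewrite -!EFinM eqe (inj_eq (mulfI (lt0r_neq0 r0))).
(* The two generators moved by [phi] are split off; the remaining terms agree by [fixed]. *)
rewrite !big_ord_recl; apply/negP.
have fixed (j : 'I_n) :
    crossing_sum R (@phi_word n) (@psi_word n) (lift ord0 (lift ord0 j), true) =
    crossing_sum R (@psi_word n) (@phi_word n) (lift ord0 (lift ord0 j), true).
  by rewrite !crossing_sum_fixed.
rewrite eq_sym !addrA (eq_bigr _ (fun j _ => fixed j)).
by rewrite (inj_eq (addIr _)) phi_psi_sum_neq.
Qed.
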